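(* Let $\mathcal{H}=\mathcal{H}(X)$ be a reproducing kernel Hilbert space on a nonempty set $X$ and let $M,N\in\mathcal{B}(\mathcal{H})$ have closed ranges. Then for every real $r\geq1$, $$\mathbf{ber}^r(M+N)\leq\frac{2^{r-1}}{\sqrt2}\,\mathbf{ber}\left(|M|^{2r}+|N|^{2r}+i\left((MM^\dagger)^r+(NN^\dagger)^r\right)\right).$$
   Context: A reproducing kernel Hilbert space $\mathcal{H}(X)$ is a complex Hilbert space of complex-valued functions on $X$ on which every evaluation $\phi\mapsto\phi(x)$, $x\in X$, is continuous; $k_x\in\mathcal{H}$ is the element with $\phi(x)=\langle\phi,k_x\rangle$ for all $\phi\in\mathcal{H}$, and $\hat k_x=k_x/\|k_x\|$ is the normalized reproducing kernel (for $k_x\ne0$). $\mathcal{B}(\mathcal{H})$ is the algebra of bounded linear operators on $\mathcal{H}$. The Berezin number is $\mathbf{ber}(T)=\sup_{x}|\langle T\hat k_x,\hat k_x\rangle|$, over all $x\in X$ for which $\hat k_x$ is defined; $\mathbf{ber}^p(T)$ means $(\mathbf{ber}(T))^p$. $|T|=\sqrt{T^*T}$, and $i$ is the imaginary unit. For a closed-range $T\in\mathcal{B}(\mathcal{H})$, $T^\dagger$ is the Moore–Penrose inverse: the unique bounded operator with $TT^\dagger T=T$, $T^\dagger TT^\dagger=T^\dagger$, $(TT^\dagger)^*=TT^\dagger$, $(T^\dagger T)^*=T^\dagger T$. Real powers of positive operators are taken via functional calculus. *)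

(* Defs.v *)
From HB Require Import structures.
From mathcomp Require Import all_boot all_order all_algebra.
From mathcomp Require Import sesquilinear.
From mathcomp Require Import complex.
From mathcomp Require Import all_classical all_reals all_analysis.

Set Implicit Arguments.
Unset Strict Implicit.
Unset Printing Implicit Defensive.

Import Order.TTheory GRing.Theory Num.Theory Num.Def.
Import numFieldNormedType.Exports.

Local Open Scope classical_set_scope.
Local Open Scope ring_scope.
Local Open Scope complex_scope.

(* Vectors of the complex Hilbert space [carrier] are identified with functions
   on [X] through the injective linear map [feval].  The inner product is linear
   in its first argument and conjugate-linear in the second one.  The regular
   module [R[i]^o] is only used to equip R[i] with its norm topology. *)
Record rkhs (R : realType) (X : Type) := Rkhs {
  carrier :> completeNormedModType R[i] ;
  inner : {dot carrier for (@conjC R[i])} ;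
  norm_innerE : forall phi, `|phi| ^+ 2 = inner phi phi ;
  feval : carrier -> X -> R[i] ;
  feval_linear : forall (a : R[i]) phi psi x,
    feval (a *: phi + psi) x = a * feval phi x + feval psi x ;
  feval_inj : injective feval ;
  feval_continuous : forall x, continuous (fun phi => feval phi x : R[i]^o) }.

Section Berezin.
Context {R : realType} {X : Type} {H : rkhs R X}.
Implicit Types (T S A B : H -> H).

Definition bounded_op T := linear T /\ continuous T.

Definition adjoint T : H -> H :=
  xget (fun=> 0) [set S | bounded_op S /\
    forall phi psi, inner H (T phi) psi = inner H phi (S psi)].

Definition mp_inverse T : H -> H :=
  xget (fun=> 0) [set S | [/\ bounded_op S,
    T \o S \o T = T,
    S \o T \o S = S,
    adjoint (T \o S) = T \o S &
    adjoint (S \o T) = S \o T]].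

Definition spectrum T : set R[i] :=
  [set z | ~ exists S, [/\ bounded_op S,
     forall phi, S (T phi - z *: phi) = phi &
     forall phi, T (S phi) - z *: S phi = phi]].

Definition poly_op (p : {poly R}) A : H -> H :=
  fun phi => \sum_(i < size p) (p`_i)%:C *: iter i A phi.

(* Continuous functional calculus for self-adjoint [A]: [B] is [f A] when
   [B] is the limit in operator norm of [p n A], for real polynomials [p n]
   converging to [f] uniformly on the spectrum of [A], which is real. *)
Definition is_funcalc A (f : R -> R) B :=
  exists p : nat -> {poly R},
    (forall e : R, 0 < e -> \forall n \near \oo,
       forall t : R, spectrum A t%:C -> `|(p n).[t] - f t| <= e) /\
    (forall e : R, 0 < e -> \forall n \near \oo,
       forall phi, `|poly_op (p n) A phi - B phi| <= e%:C * `|phi|).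

Definition funcalc A (f : R -> R) : H -> H :=
  xget (fun=> 0) [set B | bounded_op B /\ is_funcalc A f B].

Definition rpow_op A (s : R) : H -> H := funcalc A (fun t => t `^ s).

Definition abs_op T : H -> H := rpow_op (adjoint T \o T) (1 / 2).

Definition repr_kernel (x : X) : H :=
  xget 0 [set k | forall phi, feval phi x = inner H phi k].

Definition normalized_kernel (x : X) : H := `|repr_kernel x|^-1 *: repr_kernel x.

(* The norm of R[i] takes its values in R[i], whence [complex.Re].  When every
   kernel vanishes, i.e., when H = {0}, this is [sup set0 = 0]. *)
Definition ber T : R :=
  sup [set complex.Re `|inner H (T (normalized_kernel x)) (normalized_kernel x)|
      | x in [set x | repr_kernel x != 0]].

End Berezin.

(* Main.v *)
From HB Require Import structures.
Require Import Defs.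
From mathcomp Require Import all_boot all_order all_algebra.
From mathcomp Require Import sesquilinear.
From mathcomp Require Import complex.
From mathcomp Require Import all_classical all_reals all_analysis.
From mathcomp Require Import ring lra zify.

Import Order.TTheory GRing.Theory Num.Theory.
Import numFieldNormedType.Exports.

Local Open Scope classical_set_scope.
Local Open Scope ring_scope.
Local Open Scope complex_scope.

(** For a unit vector k, which will be a normalized kernel, put P = M M^dagger.
    It is the orthogonal projection onto the range of M, so
    <M k, k> = <M k, P k> and, by Cauchy-Schwarz and the inequality between
    geometric and arithmetic means,

      2 |<M k, k>|^r <= (|M k|^2)^r + (|P k|^2)^r
                     <= <|M|^(2r) k, k> + <P^r k, k>.

    The last step is McCarthy's inequality for the first term ([rpow_op_mccarthy]);
    for the second it combines |P k| <= 1, |P k|^2 = <P k, k> and P^r = P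
    ([rpow_op_proj]). Together this is [pow_inner_le]. Adding the same bound for N, convexity of t^r gives
    |<(M + N) k, k>|^r <= 2^(r-1) (s + t) / 2, where s and t are the real
    and imaginary parts of the inner product that enters the right-hand side,
    and s + t <= sqrt 2 |s + i t|. A supremum over kernels finishes the proof.

    The operators in the statement have to be shown to exist first. One
    minimisation argument, [coercive_form_representation], provides adjoints,
    inverses of coercive operators and, for an operator with closed range, the
    Moore-Penrose inverse ([mp_inverse_exists]); there the coercivity comes from
    a gliding hump argument ([closed_range_bounded_below]).

    The functional calculus rests on one fact: a real polynomial that is
    nonnegative on the spectrum of a self-adjoint A gives a positive operator
    p(A) ([poly_op_ge0]). Indeed the infimum of the quadratic form of p(A) is an
    approximate eigenvalue, hence a value of p on the spectrum, as one sees by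
    splitting p minus that number into linear factors. The fact yields the bound
    of |p(A)| by the supremum of |p| on the spectrum, thus existence and
    uniqueness of f(A), as well as the comparison of f(A) with polynomials
    below f from which McCarthy's inequality follows by taking a tangent. *)

(** * Polynomial approximation and convexity of powers *)

Section RealAnalysis.
Set Implicit Arguments.
Unset Strict Implicit.
Context {R : realType}.
Implicit Types (f : R -> R) (t s x y : R).

Lemma inv_small (e : R) : 0 < e ->
  exists n0, forall n, (n0 <= n)%N -> n.+1%:R^-1 <= e.
Proof.
move=> e0; exists (Num.trunc e^-1) => n hn.
rewrite -[e]invrK lef_pV2 ?posrE ?invr_gt0 //.
by rewrite (le_trans (ltW (truncnS_gt _))) // ler_nat ltnS.
Qed.

Lemma le_of_sqr (a b : R) : 0 <= b -> a ^+ 2 <= b ^+ 2 -> a <= b.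
Proof. by move=> b0 ab; have [//|ba] := leP a b; move: ab; rewrite !expr2; nra. Qed.

Lemma eps_le0 (a K : R) : (forall e : R, 0 < e -> e <= 1 -> a <= e * K) -> a <= 0.
Proof.
move=> h; apply/ler_addgt0Pr => e e0; rewrite add0r.
have K0 : 0 < `|K| + 1 by rewrite ltr_wpDl.
pose d := Num.min 1 (e / (`|K| + 1)).
have d0 : 0 < d by rewrite lt_min ltr01 divr_gt0.
have d1 : d <= 1 by rewrite ge_min lexx.
have dK : d * (`|K| + 1) <= e by rewrite -ler_pdivlMr // ge_min lexx orbT.
apply: le_trans (h d d0 d1) (le_trans _ dK).
by rewrite ler_pM2l // ler_wpDr // ler_norm.
Qed.

Definition poly_approx (p : nat -> {poly R}) f (D : set R) :=
  forall e : R, 0 < e -> exists n0, forall n, (n0 <= n)%N ->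
    forall t, D t -> `|(p n).[t] - f t| <= e.

(** The Bernstein polynomial of degree n with nodes h 0, ..., h n, given by de
    Casteljau's recursion: it exposes the polynomial as an average of its two
    predecessors, so that estimates go by induction on n. *)
Fixpoint bernstein (n : nat) (h : nat -> R) : {poly R} :=
  if n is n'.+1 then (1 - 'X) * bernstein n' h + 'X * bernstein n' (h \o succn)
  else (h 0%N)%:P.

(** The variance estimate behind Bernstein's proof of the approximation theorem,
    in a form that is stable under the recursion. At x the operator is the
    expectation over a binomial variable k of parameters n and x, and the factor
    of b is the second moment of k about c; passing from n to n + 1 replaces c by
    c or by c - 1 with probabilities 1 - x and x. *)
Lemma bernstein_le n (h : nat -> R) (x y a b c : R) : 0 <= x <= 1 ->
  (forall k, (k <= n)%N -> `|h k - y| <= a + b * (k%:R - c) ^+ 2) ->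
  `|(bernstein n h).[x] - y| <= a + b * (n%:R * (x * (1 - x)) + (n%:R * x - c) ^+ 2).
Proof.
move=> /andP[x0 x1]; elim: n h c => [|n IH] h c hk.
  by rewrite /= hornerC !mul0r add0r; exact: hk.
have h1 := IH h c (fun k kn => hk k (leqW kn)).
have /(IH (h \o succn)) : forall k, (k <= n)%N ->
    `|(h \o succn) k - y| <= a + b * (k%:R - (c - 1)) ^+ 2.
  move=> k kn; have := hk k.+1 kn; rewrite /= -natr1.
  by have -> : k%:R - (c - 1) = k%:R + 1 - c by ring.
move=> h2; rewrite /= hornerD !hornerM hornerX.
have -> : (1 - 'X : {poly R}).[x] = 1 - x by rewrite !hornerE.
set u := (bernstein n h).[x] in h1 *; set v := (bernstein n _).[x] in h2 *.
have -> : (1 - x) * u + x * v - y = (1 - x) * (u - y) + x * (v - y) by ring.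
rewrite (le_trans (ler_normD _ _)) // !normrM (ger0_norm x0) ger0_norm ?subr_ge0 //.
have x1' : 0 <= 1 - x by rewrite subr_ge0.
apply: le_trans (lerD (ler_wpM2l x1' h1) (ler_wpM2l x0 h2)) _.
rewrite -natr1 le_eqVlt; apply/orP; left; apply/eqP; ring.
Qed.

(** Continuity enters through a quadratic modulus: for every e, f varies by at
    most e + C (x - y)^2 on [0, L]. On a compact interval this is equivalent to
    continuity, it is what the variance estimate consumes, and it is immediate
    for the powers used below. *)
Lemma weierstrass f (L : R) : 0 < L ->
  (forall e : R, 0 < e -> exists2 C : R, 0 <= C & forall x y, 0 <= x <= L -> 0 <= y <= L ->
     `|f x - f y| <= e + C * (x - y) ^+ 2) ->
  exists p : nat -> {poly R}, poly_approx p f [set t | 0 <= t <= L].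
Proof.
move=> L0 hf.
exists (fun n => bernstein n.+1 (fun k => f (L * (k%:R / n.+1%:R))) \Po (L^-1 *: 'X)) => e e0.
have [C C0 hC] := hf _ (divr_gt0 e0 (ltr0n R 2)).
have e1 : 0 < e / 2 / (C * L ^+ 2 + 1).
  by rewrite !divr_gt0 // ltr_wpDl // mulr_ge0 // sqr_ge0.
have [n0 hn0] := inv_small e1; exists n0 => n /hn0 hn t /andP[t0 tL].
rewrite horner_comp hornerZ hornerX; set x := L^-1 * t.
have tE : t = L * x by rewrite /x mulrA mulfV ?mul1r // gt_eqF.
have x01 : 0 <= x <= 1.
  by rewrite /x mulr_ge0 ?invr_ge0 ?(ltW L0) //= mulrC ler_pdivrMr // mul1r.
move: hn; set N := n.+1%:R => hn.
have N0 : 0 < N by rewrite ltr0n.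
have := @bernstein_le n.+1 (fun k => f (L * (k%:R / N))) x (f t) (e / 2)
  (C * L ^+ 2 / N ^+ 2) (N * x) x01.
rewrite subrr expr0n addr0 => h; apply: le_trans (h _) _.
  move=> k kn; rewrite (le_trans (hC _ _ _ _)) ?t0 //.
  - have k0 : 0 <= k%:R / N by rewrite divr_ge0 // ltW.
    rewrite mulr_ge0 ?(ltW L0) //= -[leRHS]mulr1 ler_pM2l // ler_pdivrMr // mul1r.
    by rewrite ler_nat.
  - rewrite lerD2l tE le_eqVlt; apply/orP; left; apply/eqP; field.
    by rewrite gt_eqF.
have -> : C * L ^+ 2 / N ^+ 2 * (N * (x * (1 - x))) = C * L ^+ 2 * (x * (1 - x)) / N.
  by field; rewrite gt_eqF.
have CL : 0 <= C * L ^+ 2 by rewrite mulr_ge0 // sqr_ge0.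
have CL1 : 0 < C * L ^+ 2 + 1 by rewrite ltr_wpDl.
have h3 : C * L ^+ 2 * (x * (1 - x)) <= C * L ^+ 2 + 1.
  move: CL x01; set D := C * L ^+ 2 => CL /andP[x0 x1]; nra.
have h4 : (C * L ^+ 2 + 1) / N <= e / 2.
  by rewrite mulrC -ler_pdivlMr.
have : C * L ^+ 2 * (x * (1 - x)) / N <= (C * L ^+ 2 + 1) / N.
  by rewrite ler_pM2r // invr_gt0.
move: h4; move: (_ / N) (_ / N) => u v; lra.
Qed.

(** A convex function lies above its tangents. After dividing by a this is
    Bernoulli's inequality r v <= v^r + (r - 1), which is Young's inequality for
    the product v * 1. *)
Lemma powR_tangent (r a u : R) : 1 <= r -> 0 <= a -> 0 <= u ->
  a `^ r + r * a `^ (r - 1) * (u - a) <= u `^ r.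
Proof.
move=> r1 a0 u0; have r0 : 0 < r by rewrite (lt_le_trans ltr01).
have [->|rn1] := eqVneq r 1.
  by rewrite subrr powRr0 !powRr1 // mul1r mul1r addrCA subrr addr0.
have r1' : 1 < r by rewrite lt_neqAle eq_sym rn1.
move: a0; rewrite le_eqVlt => /predU1P[<-|a0].
  rewrite (powR0 (lt0r_neq0 r0)) (@powR0 _ (r - 1)) ?subr_eq0 //.
  by rewrite mulr0 mul0r addr0 powR_ge0.
pose v := u / a; have v0 : 0 <= v by rewrite divr_ge0 // ltW.
have -> : u = a * v by rewrite /v mulrCA mulfV ?mulr1 // gt_eqF.
rewrite powRM ?(ltW a0) // -(mulr_powRB1 (ltW a0) r0).
have ap : 0 < a `^ (r - 1) by exact: powR_gt0.
have q0 : 0 < r / (r - 1) by rewrite divr_gt0 // subr_gt0.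
have pq : r^-1 + (r / (r - 1))^-1 = 1.
  by field; rewrite !gt_eqF ?subr_gt0.
have := conjugate_powR v0 (@ler01 R) r0 q0 pq.
rewrite mulr1 powR1 => h.
have h2 : r * v <= v `^ r + (r - 1).
  have -> : v `^ r + (r - 1) = r * (v `^ r / r + 1 / (r / (r - 1))).
    by field; rewrite !gt_eqF ?subr_gt0.
  by rewrite ler_pM2l.
have : 0 <= a * a `^ (r - 1) * (v `^ r + (r - 1) - r * v).
  by rewrite mulr_ge0 ?subr_ge0 // mulr_ge0 // ltW.
move=> h3; rewrite -subr_ge0; apply: le_trans h3 _.
rewrite le_eqVlt; apply/orP; left; apply/eqP; ring.
Qed.

(** Jensen's inequality for t^r at the midpoint, from the tangent there. *)
Lemma powR_addr_le (a b r : R) : 0 <= a -> 0 <= b -> 1 <= r ->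
  (a + b) `^ r <= 2 `^ (r - 1) * (a `^ r + b `^ r).
Proof.
move=> a0 b0 r1; pose m := (a + b) / 2.
have m0 : 0 <= m by rewrite divr_ge0 // addr_ge0.
have := powR_tangent r1 m0 a0; have := powR_tangent r1 m0 b0.
set K := _ * _ `^ _ => h1 h2.
have h3 : 2 * m `^ r <= a `^ r + b `^ r.
  have : K * (a - m) + K * (b - m) = 0 by rewrite /m; field.
  lra.
have -> : a + b = 2 * m by rewrite /m; field.
rewrite powRM // -(@mulr_powRB1 _ 2 r) //; last by rewrite (lt_le_trans ltr01).
by rewrite (mulrC 2) -mulrA ler_wpM2l ?powR_ge0.
Qed.

(** The inequality x + y <= sqrt 2 * |x + i y| between real numbers, in the form
    in which it produces the constant 1 / sqrt 2. *)
Lemma addr_le_modulus (u v a b c d : R) : 0 <= u -> 0 <= v ->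
  2 * u <= a + c -> 2 * v <= b + d ->
  (u + v) * Num.sqrt 2 <= Num.sqrt ((a + b) ^+ 2 + (c + d) ^+ 2).
Proof.
move=> u0 v0 hu hv; apply: le_of_sqr; first exact: sqrtr_ge0.
rewrite exprMn !sqr_sqrtr ?addr_ge0 ?sqr_ge0 //.
(* (s + t)^2 <= 2 (s^2 + t^2) with s = a + b and t = c + d *)
have hst : 2 * (u + v) <= (a + b) + (c + d) by lra.
have uv : 0 <= u + v by rewrite addr_ge0.
move: (a + b) (c + d) (u + v) hst uv => s t w hst w0.
have h2 : (2 * w) ^+ 2 <= (s + t) ^+ 2 by rewrite lerXn2r ?nnegrE //; lra.
have := sqr_ge0 (s - t); move: h2; rewrite !expr2; lra.
Qed.

Lemma sqrt_approx (L : R) : 0 < L ->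
  exists p : nat -> {poly R},
    poly_approx p (fun t => t `^ (1 / 2)) [set t | 0 <= t <= L].
Proof.
move=> L0; apply: weierstrass => // e e0; exists (e ^- 3).
  by rewrite invr_ge0 exprn_ge0 // ltW.
move=> x y /andP[x0 _] /andP[y0 _]; rewrite !div1r !powR12_sqrt //.
set a := Num.sqrt x; set b := Num.sqrt y.
have -> : x = a ^+ 2 by rewrite sqr_sqrtr.
have -> : y = b ^+ 2 by rewrite sqr_sqrtr.
have a0 : 0 <= a by exact: sqrtr_ge0.
have b0 : 0 <= b by exact: sqrtr_ge0.
(* either |a - b| < e, or |a - b| e^3 <= |a - b|^4 <= (a^2 - b^2)^2 *)
have [/ltW h|h] := ltP `|a - b| e.
  by rewrite ler_wpDr // mulr_ge0 ?sqr_ge0 // invr_ge0 exprn_ge0 // ltW.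
rewrite ler_wpDl ?(ltW e0) // mulrC ler_pdivlMr ?exprn_gt0 //.
have -> : (a ^+ 2 - b ^+ 2) ^+ 2 = `|a - b| ^+ 2 * (a + b) ^+ 2.
  by rewrite real_normK ?num_real //; ring.
set d := `|a - b| in h *.
have h2 : d <= a + b by rewrite /d ler_norml; apply/andP; split; lra.
have h3 : d * e ^+ 3 <= d * (d * d ^+ 2).
  rewrite ler_wpM2l ?normr_ge0 // -exprS lerXn2r ?nnegrE ?normr_ge0 //.
  exact: ltW.
apply: le_trans h3 _.
have -> : d * (d * d ^+ 2) = d ^+ 2 * d ^+ 2 by ring.
rewrite ler_wpM2l ?sqr_ge0 // lerXn2r ?nnegrE ?normr_ge0 // addr_ge0 //.
Qed.

(** On [0, L] the power t^s is Lipschitz, again by the tangent inequality, and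
    K d <= e + (K^2 / e) d^2 turns a Lipschitz bound into a quadratic modulus. *)
Lemma powR_approx (L s : R) : 0 < L -> 1 <= s ->
  exists p : nat -> {poly R}, poly_approx p (fun t => t `^ s) [set t | 0 <= t <= L].
Proof.
move=> L0 s1; apply: weierstrass => // e e0.
have s0 : 0 < s by rewrite (lt_le_trans ltr01).
pose K := s * L `^ (s - 1); have K0 : 0 <= K by rewrite mulr_ge0 ?powR_ge0 // ltW.
have half x y : 0 <= x <= L -> 0 <= y <= L -> x `^ s - y `^ s <= K * `|x - y|.
  move=> /andP[x0 xL] /andP[y0 yL].
  have h := powR_tangent s1 x0 y0.
  have h1 : s * x `^ (s - 1) <= K.
    rewrite ler_pM2l // ge0_ler_powR ?nnegrE ?subr_ge0 // ltW //.
  have h2 : s * x `^ (s - 1) * (x - y) <= K * `|x - y|.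
    rewrite (le_trans (ler_norm _)) // normrM ler_wpM2r //.
    by rewrite ger0_norm // mulr_ge0 ?powR_ge0 // ltW.
  move: h h2; set c := s * _; have -> : c * (x - y) = - (c * (y - x)) by ring.
  lra.
exists (K ^+ 2 / e); first by rewrite divr_ge0 ?sqr_ge0 // ltW.
move=> x y hx hy; apply: (@le_trans _ _ (K * `|x - y|)).
  rewrite ler_norml half // andbT lerNl opprB distrC half //.
rewrite -(real_normK (num_real (x - y))); have := normr_ge0 (x - y); move: `|x - y| => d d0.
have Kd : 0 <= K * d by rewrite mulr_ge0.
have -> : e + K ^+ 2 / e * d ^+ 2 = K * d + ((K * d - e) ^+ 2 + K * d * e) / e.
  by field; rewrite gt_eqF.
by rewrite lerDl; apply: divr_ge0 (ltW e0); rewrite addr_ge0 ?sqr_ge0 // mulr_ge0 // ltW.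
Qed.

End RealAnalysis.

(** * The underlying real Hilbert space *)

Section Hilbert.
Set Implicit Arguments.
Unset Strict Implicit.
Context {R : realType} {X : Type} {H : rkhs R X}.
Implicit Types (x y z : H) (T S A B : H -> H) (a : R[i]) (t : R).

Local Notation "''[' x , y ]" := (inner H x y) : ring_scope.

(** The norm of H takes its values in R[i]; nrm is the same norm as a real
    number. *)
Definition nrm x : R := complex.Re `|x|.

(** The real inner product underlying the complex one. Estimates and
    minimisation only involve rdot; by innerE it determines the inner product. *)
Definition rdot x y : R := complex.Re '[x, y].

Lemma nrmE x : `|x| = (nrm x)%:C.
Proof.
have := normr_ge0 x; rewrite /nrm; case: `|x| => u v /=.
by rewrite lecE /= => /andP[/eqP-> _].
Qed.

Lemma nrm_ge0 x : 0 <= nrm x.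
Proof. by rewrite -(@lecR R) -nrmE normr_ge0. Qed.

Lemma nrm0 : nrm 0 = 0.
Proof. by rewrite /nrm normr0. Qed.

Lemma nrm_eq0 x : nrm x = 0 -> x = 0.
Proof. by move=> x0; apply/eqP; rewrite -normr_eq0 nrmE x0. Qed.

Lemma nrm_gt0 x : x <> 0 -> 0 < nrm x.
Proof.
by move=> x0; rewrite lt_def nrm_ge0 andbT; apply/eqP => /nrm_eq0.
Qed.

Lemma nrmD x y : nrm (x + y) <= nrm x + nrm y.
Proof. by rewrite -(@lecR R) rmorphD /= -!nrmE ler_normD. Qed.

Lemma nrmN x : nrm (- x) = nrm x.
Proof. by rewrite /nrm normrN. Qed.

Lemma nrmBC x y : nrm (x - y) = nrm (y - x).
Proof. by rewrite -nrmN opprB. Qed.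

Lemma nrmB_trans z x y : nrm (x - y) <= nrm (x - z) + nrm (z - y).
Proof. by rewrite -[x - y](subrKA z) nrmD. Qed.

Lemma nrmZ a x : nrm (a *: x) = complex.Re `|a| * nrm x.
Proof.
rewrite /nrm normrZ nrmE.
have := normr_ge0 a; case: `|a| => u v /=.
by rewrite lecE /= => /andP[/eqP-> _]; rewrite mul0r subr0.
Qed.

Lemma nrmZR t x : nrm (t%:C *: x) = `|t| * nrm x.
Proof.
by rewrite nrmZ normc_def /= expr0n /= addr0 sqrtr_sqr.
Qed.

Lemma nrmZi x : nrm ('i%C *: x) = nrm x.
Proof. by rewrite nrmZ normc_def /= expr0n expr1n add0r sqrtr1 mul1r. Qed.

Lemma rdot_nrm x : rdot x x = nrm x ^+ 2.
Proof. by rewrite /rdot -norm_innerE nrmE -rmorphXn. Qed.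

Lemma innerC x y : '[x, y] = ('[y, x])^*%C.
Proof. by rewrite hermC expr0 mul1r. Qed.

Lemma rdotC x y : rdot x y = rdot y x.
Proof. by rewrite /rdot innerC; case: '[y, x]. Qed.

Lemma rdotDl x y z : rdot (x + y) z = rdot x z + rdot y z.
Proof. by rewrite /rdot linearDl raddfD. Qed.

Lemma rdotNl x y : rdot (- x) y = - rdot x y.
Proof. by rewrite /rdot linearNl raddfN. Qed.

Lemma rdotBl x y z : rdot (x - y) z = rdot x z - rdot y z.
Proof. by rewrite rdotDl rdotNl. Qed.

Lemma rdotDr x y z : rdot x (y + z) = rdot x y + rdot x z.
Proof. by rewrite rdotC rdotDl !(rdotC x). Qed.

Lemma rdotNr x y : rdot x (- y) = - rdot x y.
Proof. by rewrite rdotC rdotNl (rdotC x). Qed.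

Lemma rdotBr x y z : rdot x (y - z) = rdot x y - rdot x z.
Proof. by rewrite rdotDr rdotNr. Qed.

Lemma rdot0l x : rdot 0 x = 0.
Proof. by rewrite /rdot linear0l. Qed.

Lemma rdot0r x : rdot x 0 = 0.
Proof. by rewrite rdotC rdot0l. Qed.

Lemma innerZl a x y : '[a *: x, y] = a * '[x, y].
Proof. by rewrite linearZl_LR. Qed.

Lemma innerZr a x y : '[x, a *: y] = a^*%C * '[x, y].
Proof. by rewrite innerC innerZl rmorphM /= -innerC. Qed.

Lemma rdotZl t x y : rdot (t%:C *: x) y = t * rdot x y.
Proof. by rewrite /rdot innerZl; case: '[x, y] => u v /=; rewrite mul0r subr0. Qed.

Lemma rdotZr t x y : rdot x (t%:C *: y) = t * rdot x y.
Proof. by rewrite rdotC rdotZl rdotC. Qed.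

Lemma rdotZi x y : rdot ('i%C *: x) ('i%C *: y) = rdot x y.
Proof. by rewrite /rdot innerZl innerZr; case: '[x, y] => u v /=; ring. Qed.

Lemma innerE x y : '[x, y] = rdot x y +i* rdot x ('i%C *: y).
Proof.
by rewrite /rdot innerZr; case: '[x, y] => u v /=; congr (_ +i* _); ring.
Qed.

Lemma rdot_ext x y : (forall z, rdot z x = rdot z y) -> x = y.
Proof.
move=> xy; apply/subr0_eq/nrm_eq0/eqP; rewrite -sqrf_eq0 -rdot_nrm rdotBr.
by rewrite xy subrr.
Qed.

Lemma rdot_le x y : rdot x y <= nrm x * nrm y.
Proof.
have [->|/eqP x0] := eqVneq x 0; first by rewrite rdot0l nrm0 mul0r.
have [->|/eqP y0] := eqVneq y 0; first by rewrite rdot0r nrm0 mulr0.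
have := sqr_ge0 (nrm ((nrm y)%:C *: x - (nrm x)%:C *: y)).
rewrite -rdot_nrm rdotBl !rdotBr !rdotZl !rdotZr !rdot_nrm (rdotC y x).
have xp := nrm_gt0 x0; have yp := nrm_gt0 y0.
move=> h; rewrite -(ler_pM2l (mulr_gt0 xp yp)); nra.
Qed.

Lemma rdot_norm_le x y : `|rdot x y| <= nrm x * nrm y.
Proof. by rewrite ler_norml rdot_le lerNl -rdotNl -(nrmN x) rdot_le. Qed.

(** The modulus of the inner product is its real part once y is rotated by the
    phase of the product, so the complex Cauchy-Schwarz inequality follows from
    the real one. *)
Lemma inner_norm_le x y : complex.Re `|'[x, y]| <= nrm x * nrm y.
Proof.
have [z0|z0] := eqVneq '[x, y] 0.
  by rewrite z0 normr0 mulr_ge0 ?nrm_ge0.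
set u := '[x, y] / `|'[x, y]|.
have u1 : `|u| = 1 by rewrite normrM normfV normr_id mulfV // normr_eq0.
have -> : `|'[x, y]| = '[x, u *: y].
  rewrite innerZr -[in RHS](divfK (_ : `|'[x, y]| != 0) '[x, y]) ?normr_eq0 //.
  by rewrite mulrA -/u (mulrC _ u) -[u * _]normCK u1 expr1n mul1r.
by rewrite (le_trans (rdot_le _ _)) // nrmZ u1 mul1r.
Qed.

(** * Completeness, closedness and boundedness in terms of the real norm *)

Definition converges (u : nat -> H) l :=
  forall e : R, 0 < e -> exists n0, forall n, (n0 <= n)%N -> nrm (u n - l) <= e.

Lemma complete_seq (u : nat -> H) :
  (forall e : R, 0 < e -> exists n0, forall m n, (n0 <= m)%N -> (n0 <= n)%N ->
     nrm (u m - u n) <= e) ->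
  exists l, converges u l.
Proof.
move=> cu.
have posC (e : R[i]) : 0 < e -> exists2 t, 0 < t & e = t%:C.
  case: e => a b; rewrite ltcE /= => /andP[/eqP-> a0]; by exists a.
have /cauchy_cvgP ccu : cauchy (u @ \oo).
  apply/cauchy_exP => e /posC[t t0 ->].
  have t20 : 0 < t / 2 by rewrite divr_gt0.
  have [n0 h] := cu _ t20.
  exists (u n0); exists n0 => // n /= n0n.
  rewrite -ball_normE /= nrmE ltcR (le_lt_trans (h _ _ _ _)) //.
  by rewrite ltr_pdivrMr // mulr_natr mulr2n ltrDl.
exists (lim (u @ \oo)) => e e0.
have eC : (0 : R[i]) < e%:C by rewrite ltcR.
have /cvgrPdist_lt /(_ _ eC)[n0 _ h] := ccu.
by exists n0 => n n0n; have := h n n0n; rewrite /= nrmE ltcR nrmBC => /ltW.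
Qed.

Definition seq_closed (K : set H) := forall (u : nat -> H) l,
  (forall n, K (u n)) -> converges u l -> K l.

Lemma closed_seq_closed (K : set H) : closed K -> seq_closed K.
Proof.
move=> cK u l Ku ul; apply: (closed_cvg K cK (_ : \forall n \near \oo, K (u n))).
  by apply: nearW => n; exact: Ku.
apply/cvgrPdist_lt => -[a b]; rewrite ltcE /= => /andP[/eqP-> a0].
have a20 : 0 < a / 2 by rewrite divr_gt0.
have [n0 h] := ul _ a20; exists n0 => // n /= n0n.
rewrite nrmE ltcR nrmBC (le_lt_trans (h _ n0n)) //.
by rewrite ltr_pdivrMr // mulr_natr mulr2n ltrDl.
Qed.

Lemma bounded_opP T : bounded_op T <->
  linear T /\ exists2 C : R, 0 <= C & forall x, nrm (T x) <= C * nrm x.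
Proof.
split=> -[lT]; pose T' : {linear H -> H} := HB.pack T (GRing.isLinear.Build _ _ _ _ _ lT).
  move=> cT; split=> //.
  have /linear_bounded_continuous := cT : continuous T'.
  move=> /linear_boundedP[y [yr h]].
  exists (`|complex.Re y| + 1); first by rewrite addr_ge0.
  move=> x; have := h ((`|complex.Re y| + 1)%:C) _ x.
  rewrite -(@lecR R) rmorphM /= -!nrmE; apply.
  by rewrite -(RRe_real yr) ltcR (le_lt_trans (ler_norm _)) // ltrDl.
move=> [C C0 h]; split=> //.
apply/(linear_bounded_continuous T')/linear_boundedP.
exists C%:C; split.
  by rewrite realE lecR C0.
move=> [a b]; rewrite ltcE /= => /andP[/eqP-> Ca] x.
have -> : a +i* 0 = a%:C by [].
rewrite !nrmE -rmorphM lecR (le_trans (h _)) // ler_wpM2r ?nrm_ge0 //.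
exact: ltW.
Qed.

Lemma linD T : linear T -> forall x y, T (x + y) = T x + T y.
Proof. by move=> lT x y; rewrite -[x]scale1r lT !scale1r. Qed.

Lemma lin0 T : linear T -> T 0 = 0.
Proof. by move=> lT; apply: (addIr (T 0)); rewrite -linD // !add0r. Qed.

Lemma linZ T : linear T -> forall a x, T (a *: x) = a *: T x.
Proof. by move=> lT a x; rewrite -[a *: x]addr0 lT lin0 // addr0. Qed.

Lemma linN T : linear T -> forall x, T (- x) = - T x.
Proof. by move=> lT x; rewrite -scaleN1r linZ // scaleN1r. Qed.

Lemma linB T : linear T -> forall x y, T (x - y) = T x - T y.
Proof. by move=> lT x y; rewrite linD // linN. Qed.

(** * Coercive forms and adjoints *)

(** The representation theorem for a coercive symmetric form on a closed
    subspace K: k is the minimiser of the energy J v = q v v - 2 f v. The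
    parallelogram law for q makes minimising sequences Cauchy, and the first
    variation of J vanishes in the limit. This one statement yields adjoints
    (q the real inner product), inverses of coercive operators (q x y = <A x, y>) and
    the Moore-Penrose inverse (q x y = <T^* x, T^* y> on the range of T). *)
Lemma coercive_form_representation (K : set H) (q : H -> H -> R) (f : H -> R) (C c D : R) :
  K 0 -> (forall t x y, K x -> K y -> K (x + t%:C *: y)) -> seq_closed K ->
  (forall t x y z, q (x + t%:C *: y) z = q x z + t * q y z) ->
  (forall x y, q x y = q y x) ->
  (forall x y, `|q x y| <= C * nrm x * nrm y) ->
  0 < c -> (forall x, K x -> c * nrm x ^+ 2 <= q x x) ->
  (forall t x y, f (x + t%:C *: y) = f x + t * f y) ->
  (forall x, `|f x| <= D * nrm x) ->
  exists2 k, K k & forall v, K v -> q k v = f v.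
Proof.
move=> K0 KD Kc qD qC qle c0 qc fD fle.
pose J v := q v v - 2 * f v.
have f0 : f 0 = 0 by have := fle 0; rewrite nrm0 mulr0 normr_le0 => /eqP.
have q0 x : q 0 x = 0.
  by have := qle 0 x; rewrite nrm0 mulr0 mul0r normr_le0 => /eqP.
have JD t k v : J (k + t%:C *: v) = J k + 2 * t * (q k v - f v) + t ^+ 2 * q v v.
  by rewrite /J fD qD ![q _ (k + _)]qC !qD (qC v k); ring.
have infJ : has_inf [set J v | v in K].
  split; first by exists (J 0), 0.
  exists (- (D ^+ 2 / c)) => _ [v Kv <-].
  have h1 := qc v Kv; have := fle v; rewrite ler_norml => /andP[_ h2].
  have h3 : 0 <= c^-1 * (c * nrm v - D) ^+ 2 by rewrite mulr_ge0 ?sqr_ge0 ?invr_ge0 ?ltW.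
  have h4 : c^-1 * (c * nrm v - D) ^+ 2 = c * nrm v ^+ 2 - 2 * (D * nrm v) + D ^+ 2 / c.
    by field; rewrite gt_eqF.
  rewrite /J; lra.
pose d := inf [set J v | v in K].
have dJ v : K v -> d <= J v by move=> Kv; apply: ge_inf; [case: infJ | exists v].
have /choice[k hk] n : exists v, K v /\ J v <= d + n.+1%:R^-1.
  have n0 : 0 < (n.+1%:R^-1 : R) by rewrite invr_gt0.
  have [_ [v Kv <-] Jv] := inf_adherent n0 infJ.
  by exists v; split => //; exact: ltW.
have Kk n : K (k n) by case: (hk n).
have Jk n : J (k n) <= d + n.+1%:R^-1 by case: (hk n).
(* parallelogram law: the midpoint of k i and k j has energy at least d *)
have ck i j : c * nrm (k i - k j) ^+ 2 <= 2 * (i.+1%:R^-1 + j.+1%:R^-1).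
  have Kd : K (k i - k j).
    have := KD (-1) _ _ (Kk i) (Kk j).
    by rewrite rmorphN rmorph1 scaleN1r.
  apply: le_trans (qc _ Kd) _.
  have -> : q (k i - k j) (k i - k j) = q (k i) (k i) - 2 * q (k i) (k j) + q (k j) (k j).
    have -> : k i - k j = k i + (-1)%:C *: k j.
      by rewrite rmorphN rmorph1 scaleN1r.
    by rewrite qD !(qC _ (_ + _)) !qD (qC (k j) (k i)); ring.
  have := dJ _ (KD (1/2) _ _ (KD (1/2) _ _ K0 (Kk i)) (Kk j)).
  rewrite !JD qD !q0 /J q0 f0.
  have := Jk i; have := Jk j; rewrite /J /=.
  move: (_^-1) (_^-1) => a b; rewrite expr2; lra.
have [|l hl] := @complete_seq k.
  move=> e e0; have ce : 0 < c * e ^+ 2 / 4 by rewrite divr_gt0 ?mulr_gt0 ?exprn_gt0.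
  have [n0 h] := inv_small ce; exists n0 => i j hi hj.
  apply: le_of_sqr; first exact: ltW.
  rewrite -(ler_pM2l c0).
  apply: le_trans (ck i j) _; move: (h i hi) (h j hj).
  move: (i.+1%:R^-1) (j.+1%:R^-1) => a b; lra.
have Kl : K l by exact: Kc hl.
(* t = - g / (q v v + 1) nearly minimises J (k n + t v); the 1 avoids a zero denominator *)
have gk n v : K v -> (q (k n) v - f v) ^+ 2 <= (q v v + 1) / n.+1%:R.
  move=> Kv; have qv : 0 <= q v v by rewrite (le_trans _ (qc v Kv)) // mulr_ge0 ?sqr_ge0 ?ltW.
  have Q1 : 0 < q v v + 1 by rewrite ltr_wpDl.
  have := dJ _ (KD (- (q (k n) v - f v) / (q v v + 1)) _ _ (Kk n) Kv).
  rewrite JD; set g := q _ _ - _; have := Jk n; set e := _^-1; set Q := q v v + 1.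
  have -> : q v v = Q - 1 by rewrite /Q addrK.
  have -> : J (k n) + 2 * (- g / Q) * g + (- g / Q) ^+ 2 * (Q - 1) =
    J (k n) - g ^+ 2 / Q - (g / Q) ^+ 2 by field; rewrite gt_eqF.
  have := sqr_ge0 (g / Q) => h1 h2 h3.
  rewrite -ler_pdivrMl //; rewrite mulrC; lra.
exists l => // v Kv; apply/eqP; rewrite -subr_eq0 -normr_le0.
apply/ler_addgt0Pr => e e0; rewrite add0r.
have qv : 0 <= q v v by rewrite (le_trans _ (qc v Kv)) // mulr_ge0 ?sqr_ge0 ?ltW.
have Q1 : 0 < q v v + 1 by rewrite ltr_wpDl.
have C1 : 0 < `|C| * nrm v + 1 by rewrite ltr_wpDl // mulr_ge0 ?nrm_ge0.
have e1 : 0 < (e / 2) ^+ 2 / (q v v + 1) by rewrite divr_gt0 // exprn_gt0 // divr_gt0.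
have e2 : 0 < e / 2 / (`|C| * nrm v + 1) by rewrite !divr_gt0.
have [n1 h1] := inv_small e1; have [n2 h2] := hl _ e2.
pose n := maxn n1 n2.
have a1 : `|q (k n) v - f v| <= e / 2.
  apply: le_of_sqr; first by rewrite divr_ge0 // ltW.
  rewrite real_normK ?num_real //.
  rewrite (le_trans (gk n v Kv)) // mulrC -ler_pdivlMr //.
  by rewrite h1 // leq_maxl.
have a2 : `|q (k n - l) v| <= e / 2.
  apply: le_trans (qle _ _) _; rewrite -mulrA mulrCA.
  apply: (@le_trans _ _ (nrm (k n - l) * (`|C| * nrm v + 1))).
    rewrite ler_wpM2l ?nrm_ge0 // ler_wpDr // ler_wpM2r ?nrm_ge0 //.
    exact: ler_norm.
  by rewrite -ler_pdivlMr // h2 // leq_maxr.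
have a3 : q (k n - l) v = q (k n) v - q l v.
  have -> : k n - l = k n + (-1)%:C *: l by rewrite rmorphN rmorph1 scaleN1r.
  by rewrite qD mulN1r.
have -> : q l v - f v = (q (k n) v - f v) - q (k n - l) v by rewrite a3; ring.
rewrite (le_trans (ler_normB _ _)) //; lra.
Qed.

Lemma inner_ext x y : (forall z, '[z, x] = '[z, y]) -> x = y.
Proof. by move=> xy; apply: rdot_ext => z; rewrite /rdot xy. Qed.

(** A real-linear identity that holds on a subspace stable under multiplication
    by the imaginary unit holds for the complex inner product. *)
Lemma inner_of_rdot (K : set H) T x y : linear T ->
  (forall v, K v -> K ('i%C *: v)) ->
  (forall v, K v -> rdot x (T v) = rdot y v) ->
  forall v, K v -> '[x, T v] = '[y, v].
Proof.
by move=> lT Ki xy v Kv; rewrite !innerE -linZ // !xy //; exact: Ki.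
Qed.

Lemma innerDl x y z : '[x + y, z] = '[x, z] + '[y, z].
Proof. by rewrite linearDl. Qed.

Lemma innerDr x y z : '[z, x + y] = '[z, x] + '[z, y].
Proof. by rewrite linearDr. Qed.

Definition adjoint_pair T S := forall x y, '[T x, y] = '[x, S y].

Lemma adjoint_pairC T S : adjoint_pair T S -> adjoint_pair S T.
Proof. by move=> TS x y; rewrite innerC -TS -innerC. Qed.

Lemma adjoint_pair_rdot T S : adjoint_pair T S ->
  forall x y, rdot (T x) y = rdot x (S y).
Proof. by move=> TS x y; rewrite /rdot TS. Qed.

Lemma adjoint_pair_linear T S : adjoint_pair T S -> linear S.
Proof.
move=> TS a u v; apply: inner_ext => z.
by rewrite -TS !innerDr !innerZr !TS.
Qed.

Lemma adjoint_pair_unique T S S' :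
  adjoint_pair T S -> adjoint_pair T S' -> S = S'.
Proof. by move=> h h'; apply/funext => y; apply: inner_ext => z; rewrite -h -h'. Qed.

Lemma adjoint_pair_bound T S (C : R) : adjoint_pair T S ->
  (forall x, nrm (T x) <= C * nrm x) -> forall x, nrm (S x) <= C * nrm x.
Proof.
move=> TS hT y; have [->|/eqP S0] := eqVneq (S y) 0.
  by rewrite nrm0 (le_trans _ (hT y)) ?nrm_ge0.
rewrite -(ler_pM2l (nrm_gt0 S0)) -expr2 -rdot_nrm -(adjoint_pair_rdot TS).
rewrite (le_trans (rdot_le _ _)) // mulrA (mulrC (nrm (S y))) ler_wpM2r ?nrm_ge0 //.
Qed.

Lemma adjoint_pair_bounded T S : bounded_op T -> adjoint_pair T S -> bounded_op S.
Proof.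
move=> /bounded_opP[lT [C C0 hT]] TS; apply/bounded_opP; split.
  exact: adjoint_pair_linear TS.
by exists C => // x; exact: (adjoint_pair_bound TS).
Qed.

Lemma adjoint_exists T : bounded_op T -> exists S, adjoint_pair T S.
Proof.
move=> /bounded_opP[lT [C C0 hT]].
suff /choice[S hS] y : exists k, forall v, '[y, T v] = '[k, v].
  by exists S => x y; rewrite innerC hS -innerC.
have [||||||||||k _ hk] := @coercive_form_representation setT rdot (fun v => rdot y (T v))
  1 1 (C * nrm y).
- by [].
- by [].
- by [].
- by move=> t u v z; rewrite rdotDl rdotZl.
- exact: rdotC.
- by move=> u v; rewrite mul1r rdot_norm_le.
- exact: ltr01.
- by move=> u _; rewrite mul1r rdot_nrm.
- by move=> t u v; rewrite linD // linZ // rdotDr rdotZr.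
- move=> u; rewrite (le_trans (rdot_norm_le _ _)) // mulrC mulrAC.
  by rewrite ler_wpM2r ?nrm_ge0.
by exists k => v; apply: (@inner_of_rdot setT) => // w _; rewrite hk.
Qed.

Lemma adjointP T : bounded_op T -> adjoint_pair T (adjoint T).
Proof.
move=> bT; have [S TS] := adjoint_exists bT.
rewrite /adjoint; case: xgetP => [_ -> []//|/(_ S)[]]; split=> //.
exact: adjoint_pair_bounded TS.
Qed.

Lemma adjointE T S : bounded_op T -> adjoint_pair T S -> adjoint T = S.
Proof. by move=> bT; apply: adjoint_pair_unique; exact: adjointP. Qed.

Lemma bounded_adjoint T : bounded_op T -> bounded_op (adjoint T).
Proof. by move=> bT; apply: adjoint_pair_bounded (adjointP bT). Qed.

Definition selfadj A := adjoint_pair A A.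

Lemma coercive_inverse A (c : R) : bounded_op A -> selfadj A -> 0 < c ->
  (forall x, c * nrm x ^+ 2 <= rdot (A x) x) ->
  exists S, [/\ bounded_op S, cancel A S & cancel S A].
Proof.
move=> /bounded_opP[lA [C C0 hA]] sA c0 cA.
suff /choice[S hS] y : exists k, A k = y.
  have iA x y : A x = A y -> x = y.
    move=> xy; apply/subr0_eq/nrm_eq0/eqP; rewrite -sqrf_eq0 -normr_le0.
    rewrite ger0_norm ?sqr_ge0 // -(ler_pM2l c0) mulr0 (le_trans (cA _)) //.
    by rewrite linB // xy subrr rdot0l.
  exists S; split=> //; last by move=> x; apply: iA.
  apply/bounded_opP; split.
    by move=> a u v; apply: iA; rewrite lA !hS.
  exists c^-1; first by rewrite invr_ge0 ltW.
  move=> y; have [->|/eqP S0] := eqVneq (S y) 0.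
    by rewrite nrm0 mulr_ge0 ?invr_ge0 ?nrm_ge0 ?ltW.
  rewrite -ler_pdivrMl ?invr_gt0 // invrK -(ler_pM2r (nrm_gt0 S0)).
  by rewrite -mulrA -expr2 (le_trans (cA _)) // hS rdot_le.
have [||||||||||k _ hk] := @coercive_form_representation setT (fun u v => rdot (A u) v)
  (fun v => rdot y v) C c (nrm y).
- by [].
- by [].
- by [].
- by move=> t u v z; rewrite linD // linZ // rdotDl rdotZl.
- by move=> u v; rewrite (adjoint_pair_rdot sA) rdotC.
- by move=> u v; rewrite (le_trans (rdot_norm_le _ _)) // ler_wpM2r ?nrm_ge0.
- by [].
- by move=> u _; exact: cA.
- by move=> t u v; rewrite rdotDr rdotZr.
- by move=> u; exact: rdot_norm_le.
by exists k; apply: rdot_ext => z; rewrite rdotC hk // rdotC.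
Qed.

(** * Closed range and the Moore-Penrose inverse *)

Lemma nrm_lim_le (u : nat -> H) l z (b : R) n1 :
  converges u l ->
  (forall n, (n1 <= n)%N -> nrm (u n - z) <= b) -> nrm (l - z) <= b.
Proof.
move=> ul uz; apply/ler_addgt0Pr => e e0; have [n0 h] := ul e e0.
rewrite (le_trans (nrmB_trans (u (maxn n0 n1)) _ _)) // addrC lerD //.
  by rewrite uz // leq_maxr.
by rewrite nrmBC h // leq_maxl.
Qed.

(** The quantitative content of closedness of the range. If T^* were not bounded
    below on the range of T, there would be unit vectors y_n in the range with
    |T^* y_n| at most 3^-n / (n + 1). Adding 3^-n y_n with suitable signs builds
    a point l of the closed range with |<l, y_n>| >= 3^-n / 2 for every n; but
    l = T u gives |<l, y_n>| = |<u, T^* y_n>| <= |u| 3^-n / (n + 1). This is the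
    gliding hump argument for uniform boundedness. *)
Lemma closed_range_bounded_below T S : bounded_op T -> adjoint_pair T S ->
  closed (range T) ->
  exists2 c : R, 0 < c & forall y, range T y -> c * nrm y <= nrm (S y).
Proof.
move=> /bounded_opP[lT [C C0 hT]] TS /closed_seq_closed cl.
have lS := adjoint_pair_linear TS.
apply: contrapT => nex.
pose p n : R := (3^-1) ^+ n.
have p0 n : 0 < p n by rewrite exprn_gt0 // invr_gt0.
have pS n : p n.+1 = p n / 3 by rewrite /p exprSr.
have /choice[y hy] n : exists y,
    [/\ range T y, nrm y = 1 & nrm (S y) <= p n / n.+1%:R].
  apply: contrapT => ny; apply: nex; exists (p n / n.+1%:R).
    by rewrite divr_gt0.
  move=> z [w _ wz]; have [->|/eqP z0] := eqVneq z 0.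
    by rewrite nrm0 mulr0 nrm_ge0.
  rewrite leNgt; apply/negP => lt; apply: ny.
  have z1 := nrm_gt0 z0; have z1' : 0 < (nrm z)^-1 by rewrite invr_gt0.
  exists ((nrm z)^-1%:C *: z); split.
  - by exists ((nrm z)^-1%:C *: w) => //; rewrite linZ // wz.
  - by rewrite nrmZR gtr0_norm // mulVf // gt_eqF.
  - by rewrite linZ // nrmZR gtr0_norm // mulrC ler_pdivrMr // ltW.
(* the choice of sign makes |<x, y n>| grow by p n *)
pose step n x := x + (if 0 <= rdot x (y n) then p n else - p n)%:C *: y n.
pose x := fix x n := if n is n'.+1 then step n' (x n') else 0.
have y1 n : nrm (y n) = 1 by case: (hy n).
have xS n : nrm (x n.+1 - x n) <= p n.
  rewrite /= /step addrC addKr nrmZR y1 mulr1.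
  by case: ifP => _; rewrite ?normrN gtr0_norm.
have xy n : p n <= `|rdot (x n.+1) (y n)|.
  rewrite /= /step rdotDl rdotZl rdot_nrm y1 expr1n mulr1.
  have pn := p0 n; case: (leP 0 (rdot (x n) (y n))) => h.
    by rewrite ger0_norm ?lerDr // addr_ge0 // ltW.
  by rewrite ler0_norm ?opprD ?opprK ?lerDr ?oppr_ge0; lra.
have xD n k : nrm (x (n + k)%N - x n) <= 3 / 2 * (p n - p (n + k)%N).
  elim: k => [|k IH]; first by rewrite addn0 !subrr nrm0 mulr0.
  rewrite addnS (le_trans (nrmB_trans (x (n + k)%N) _ _)) //.
  apply: le_trans (lerD (xS _) IH) _; rewrite pS; lra.
have xd n m : (n <= m)%N -> nrm (x m - x n) <= 3 / 2 * p n.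
  move=> nm; rewrite -(subnKC nm) (le_trans (xD _ _)) // ler_wpM2l ?divr_ge0 //.
  by rewrite gerBl ltW.
have psmall (e : R) : 0 < e -> exists n0, 3 / 2 * p n0 <= e.
  move=> e0; have e1 : 0 < e / (3 / 2) by rewrite !divr_gt0.
  have [n0 h] := inv_small e1; exists n0.
  rewrite mulrC -ler_pdivlMr ?divr_gt0 //; apply: le_trans (h _ (leqnn _)).
  rewrite /p exprVn lef_pV2 ?posrE ?exprn_gt0 // -natrX ler_nat.
  by elim: {h} n0 => // n; rewrite expnS; lia.
have [|l hl] := @complete_seq x.
  move=> e e0; have [n0 h] := psmall _ (divr_gt0 e0 (ltr0n R 2)).
  exists n0 => m n hm hn; rewrite (le_trans (nrmB_trans (x n0) _ _)) //.
  have := xd _ _ hm; have := xd _ _ hn; rewrite (nrmBC (x n)).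
  move: h; lra.
have [u _ ul] : range T l.
  apply: cl hl => n; elim: n => [|n [w _ IH]].
    by exists 0; rewrite ?lin0.
  have [[v _ vy] _ _] := hy n; rewrite /= /step -IH -vy.
  by eexists; [|rewrite -linZ // -linD //].
have ly n : p n / 2 <= `|rdot l (y n)|.
  have h1 : nrm (l - x n.+1) <= p n / 2.
    have -> : p n / 2 = 3 / 2 * p n.+1 by rewrite pS; field.
    by apply: (nrm_lim_le hl) => m; exact: xd.
  have h2 : `|rdot (l - x n.+1) (y n)| <= p n / 2.
    by rewrite (le_trans (rdot_norm_le _ _)) // y1 mulr1.
  have := xy n; have := ler_normB (rdot l (y n)) (rdot (l - x n.+1) (y n)).
  rewrite {1}rdotBl opprB addrC subrK; move: h2; lra.
have [n hn] : exists n, n.+1%:R > 2 * nrm u.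
  by exists (Num.trunc (2 * nrm u)); exact: truncnS_gt.
have := ly n; rewrite leNgt => /negP; apply.
rewrite -ul (adjoint_pair_rdot TS) (le_lt_trans (rdot_norm_le _ _)) //.
have [_ _ hSy] := hy n.
apply: (@le_lt_trans _ _ (nrm u * (p n / n.+1%:R))).
  by rewrite ler_wpM2l ?nrm_ge0.
rewrite mulrCA ltr_pM2l // ltr_pdivrMr //; move: hn; move: n.+1%:R => N; lra.
Qed.

Lemma bounded_comp T S : bounded_op T -> bounded_op S -> bounded_op (T \o S).
Proof.
move=> /bounded_opP[lT [C C0 hT]] /bounded_opP[lS [D D0 hS]]; apply/bounded_opP.
split; first by move=> a u v; rewrite /= lS lT.
exists (C * D); first exact: mulr_ge0.
by move=> x; rewrite (le_trans (hT _)) // -mulrA ler_wpM2l.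
Qed.

Lemma bounded_id : bounded_op (@idfun H).
Proof. by apply/bounded_opP; split=> //; exists 1 => // x; rewrite mul1r. Qed.

Lemma bounded_lin a T S : bounded_op T -> bounded_op S ->
  bounded_op (fun x => a *: T x + S x).
Proof.
move=> /bounded_opP[lT [C C0 hT]] /bounded_opP[lS [D D0 hS]]; apply/bounded_opP.
split.
  by move=> b u v; rewrite lT lS !scalerDr !scalerA (mulrC a) addrACA.
exists (complex.Re `|a| * C + D).
  rewrite addr_ge0 // mulr_ge0 //; by case: a => a1 a2 /=; exact: sqrtr_ge0.
move=> x; rewrite (le_trans (nrmD _ _)) // nrmZ mulrDl lerD // -mulrA ler_wpM2l //.
by case: a => a1 a2 /=; exact: sqrtr_ge0.
Qed.

Lemma bounded_zero : bounded_op (fun _ : H => 0 : H).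
Proof.
apply/bounded_opP; split; first by move=> a u v; rewrite scaler0 addr0.
by exists 0 => // x; rewrite nrm0 mul0r.
Qed.

Lemma boundedZ a T : bounded_op T -> bounded_op (fun x => a *: T x).
Proof.
move=> bT; have := bounded_lin a bT bounded_zero.
by congr bounded_op; apply/funext => x; rewrite addr0.
Qed.

Lemma boundedD T S : bounded_op T -> bounded_op S -> bounded_op (fun x => T x + S x).
Proof.
move=> bT bS; have := bounded_lin 1 bT bS.
by congr bounded_op; apply/funext => x; rewrite scale1r.
Qed.

Lemma adjoint_pair_comp T S T' S' : adjoint_pair T S -> adjoint_pair T' S' ->
  adjoint_pair (T \o T') (S' \o S).
Proof. by move=> h h' x y; rewrite /= h h'. Qed.

(** On the closed subspace K = range T the form <T^* x, T^* y> is coercive, so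
    every y has a unique G y in K with <T^* G y, T^* v> = <y, v> for v in K.
    Hence T T^* G is the orthogonal projection onto K, and T^* G satisfies the
    four Penrose equations. *)
Lemma mp_inverse_exists T : bounded_op T -> closed (range T) ->
  exists S, [/\ bounded_op S,
    T \o S \o T = T,
    S \o T \o S = S,
    adjoint (T \o S) = T \o S &
    adjoint (S \o T) = S \o T].
Proof.
move=> bT cT; have adT := adjointP bT; set T' := adjoint T in adT *.
have bT' : bounded_op T' := bounded_adjoint bT.
have [c c0 hc] := closed_range_bounded_below bT adT cT.
have [lT [C C0 hT]] := (bounded_opP T).1 bT.
have lT' := adjoint_pair_linear adT.
have hT' := adjoint_pair_bound adT hT.
have KZ a x : range T x -> range T (a *: x).
  by move=> [w _ <-]; exists (a *: w) => //; rewrite linZ.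
have KD x y : range T x -> range T y -> range T (x + y).
  by move=> [w _ <-] [w' _ <-]; exists (w + w') => //; rewrite linD.
have /choice[G hG] y : exists k, range T k /\
    forall v, range T v -> '[T' k, T' v] = '[y, v].
  have [||||||||||k Kk hk] := @coercive_form_representation (range T)
      (fun u v => rdot (T' u) (T' v)) (fun v => rdot y v)
      (C * C) (c ^+ 2) (nrm y).
  - by exists 0; rewrite ?lin0.
  - by move=> t u v Ku Kv; apply: KD => //; exact: KZ.
  - exact: closed_seq_closed.
  - by move=> t u v z; rewrite linD // linZ // rdotDl rdotZl.
  - by move=> u v; exact: rdotC.
  - move=> u v; rewrite (le_trans (rdot_norm_le _ _)) //.
    have -> : C * C * nrm u * nrm v = (C * nrm u) * (C * nrm v) by ring.
    by rewrite ler_pM ?nrm_ge0.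
  - exact: exprn_gt0.
  - move=> u Ku; rewrite rdot_nrm -exprMn lerXn2r ?nnegrE ?mulr_ge0 ?nrm_ge0 ?(ltW c0) //.
    exact: hc.
  - by move=> t u v; rewrite rdotDr rdotZr.
  - by move=> u; exact: rdot_norm_le.
  exists k; split=> // v Kv; apply: (@inner_of_rdot (range T)) => // u Ku.
  exact: KZ.
have GK y : range T (G y) by case: (hG y).
have Gin y v : range T v -> '[T' (G y), T' v] = '[y, v] by case: (hG y) => _; apply.
have Guniq k y : range T k -> (forall v, range T v -> '[T' k, T' v] = '[y, v]) ->
    k = G y.
  move=> Kk hk; apply/subr0_eq/nrm_eq0.
  have Kd : range T (k - G y) by rewrite -scaleN1r; apply: KD => //; exact: KZ.
  have : nrm (T' (k - G y)) = 0.
    apply/eqP; rewrite -sqrf_eq0 -rdot_nrm {1}(linB lT') rdotBl /rdot hk // Gin //.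
    by rewrite subrr.
  move=> h; apply/eqP; rewrite eq_le nrm_ge0 andbT -(ler_pM2l c0) mulr0 -h.
  exact: hc.
have lG : linear G.
  move=> a u v; apply/esym/Guniq; first by apply: KD => //; exact: KZ.
  by move=> w Kw; rewrite lT' !innerDl !innerZl !Gin.
have bG : bounded_op G.
  apply/bounded_opP; split=> //; exists (c ^- 2).
    by rewrite invr_ge0 exprn_ge0 // ltW.
  move=> y; have [->|/eqP G0] := eqVneq (G y) 0.
    by rewrite nrm0 mulr_ge0 ?nrm_ge0 // invr_ge0 exprn_ge0 // ltW.
  rewrite -ler_pdivrMl ?invr_gt0 ?exprn_gt0 // invrK -(ler_pM2r (nrm_gt0 G0)).
  rewrite -mulrA -expr2 -exprMn (@le_trans _ _ (nrm (T' (G y)) ^+ 2)) //.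
    by rewrite lerXn2r ?nnegrE ?mulr_ge0 ?nrm_ge0 ?(ltW c0) ?hc.
  by rewrite -rdot_nrm /rdot Gin // -/(rdot _ _) rdot_le.
have PK y v : range T v -> '[T (T' (G y)), v] = '[y, v] by move=> Kv; rewrite adT Gin.
have Pid y : range T y -> T (T' (G y)) = y.
  move=> Ky; apply/subr0_eq/nrm_eq0/eqP; rewrite -sqrf_eq0 -rdot_nrm.
  have Kd : range T (T (T' (G y)) - y) by rewrite -scaleN1r; apply: KD; [exists (T' (G y))|exact: KZ].
  by rewrite rdotBl /rdot PK // subrr.
have KT x : range T (T x) by exists x.
have bS : bounded_op (T' \o G) by exact: bounded_comp.
exists (T' \o G); split=> //.
- by apply/funext => x /=; rewrite Pid.
- apply/funext => x /=; congr T'; apply: Guniq => // v Kv.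
  by rewrite Gin // PK.
- apply: adjointE; first exact: bounded_comp.
  by move=> x y /=; rewrite innerC -[in LHS]PK // -innerC PK.
- apply: adjointE; first exact: bounded_comp.
  move=> x y /=; rewrite (adjoint_pairC adT) innerC -Gin // -innerC Gin //.
Qed.

Lemma mp_inverseP T : bounded_op T -> closed (range T) ->
  [/\ bounded_op (mp_inverse T), T \o mp_inverse T \o T = T &
      selfadj (T \o mp_inverse T)].
Proof.
move=> bT cT; have [S hS] := mp_inverse_exists bT cT.
rewrite /mp_inverse; case: xgetP => [_ ->|/(_ S)//] [bS TST _ aTS _].
by split=> //; rewrite /selfadj -{2}aTS; apply: adjointP; exact: bounded_comp.
Qed.

(** * The spectrum of a self-adjoint operator *)

Definition bounded_below T := exists2 c : R, 0 < c & forall x, c * nrm x <= nrm (T x).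

Lemma bounded_below_comp T S : bounded_below T -> bounded_below S ->
  bounded_below (T \o S).
Proof.
move=> [c c0 hT] [d d0 hS]; exists (c * d); first exact: mulr_gt0.
by move=> x; rewrite -mulrA (le_trans _ (hT _)) // ler_pM2l.
Qed.

(** A bounded inverse would bound A - a from below. Through this implication
    approximate eigenvalues become points of the spectrum, which is how
    positivity passes from the spectrum to the operator. *)
Lemma spectrum_not_bounded_below A a :
  ~ bounded_below (fun x => A x - a *: x) -> spectrum A a.
Proof.
move=> nb [S [/bounded_opP[lS [C C0 hS]] SA _]]; apply: nb.
exists (C + 1)^-1; first by rewrite invr_gt0 ltr_wpDl.
move=> x; rewrite mulrC ler_pdivrMr ?ltr_wpDl // -{1}(SA x) (le_trans (hS _)) //.
by rewrite mulrC ler_wpM2l ?nrm_ge0 // lerDl.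
Qed.

Lemma selfadj_rdot A : selfadj A -> forall x y, rdot (A x) y = rdot x (A y).
Proof. exact: adjoint_pair_rdot. Qed.

Lemma selfadj_inner A x : selfadj A -> '[A x, x] = (rdot (A x) x)%:C.
Proof.
move=> sA; rewrite innerE; have := innerE (A x) x; rewrite {1}sA innerC.
by rewrite [in LHS]innerE => -[] /= h; congr (_ +i* _); lra.
Qed.

(** The imaginary part of <A x - a x, x> is - Im a |x|^2, as <A x, x> is real. *)
Lemma selfadj_nonreal_bounded_below A a : selfadj A -> complex.Im a != 0 ->
  bounded_below (fun x => A x - a *: x).
Proof.
move=> sA a0; exists `|complex.Im a|; first by rewrite normr_gt0.
move=> x; have [->|/eqP x0] := eqVneq x 0; first by rewrite nrm0 mulr0 nrm_ge0.
rewrite -(ler_pM2r (nrm_gt0 x0)).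
have <- : `|rdot (A x - a *: x) ('i%C *: x)| = `|complex.Im a| * nrm x * nrm x.
  have -> : rdot (A x - a *: x) ('i%C *: x) = complex.Im '[A x - a *: x, x].
    by rewrite innerE.
  rewrite innerDl -scaleNr innerZl selfadj_inner // -norm_innerE nrmE -rmorphXn /=.
  case: a {a0} => s t /=; rewrite -[in RHS]normrN -mulrA -expr2.
  rewrite -[in RHS](ger0_norm (sqr_ge0 (nrm x))) -normrM; congr (`|_|); ring.
by rewrite (le_trans (rdot_norm_le _ _)) // nrmZi.
Qed.

Lemma selfadj_lt_not_spectrum A (t c : R) : bounded_op A -> selfadj A -> 0 < c ->
  (forall x, c * nrm x ^+ 2 <= rdot (A x) x - t * nrm x ^+ 2) ->
  ~ spectrum A t%:C.
Proof.
move=> bA sA c0 h; apply.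
have [||||S [bS SA AS]] := @coercive_inverse (fun x => - t%:C *: x + A x) c.
- exact: bounded_lin bounded_id bA.
- by move=> x y; rewrite innerDl innerDr innerZl innerZr sA -rmorphN conjc_real.
- by [].
- by move=> x; rewrite rdotDl -rmorphN rdotZl rdot_nrm mulNr addrC.
exists S; split=> // x; first by rewrite -scaleNr addrC SA.
by rewrite -scaleNr addrC AS.
Qed.

Lemma selfadj_gt_not_spectrum A (t c : R) : bounded_op A -> selfadj A -> 0 < c ->
  (forall x, c * nrm x ^+ 2 <= t * nrm x ^+ 2 - rdot (A x) x) ->
  ~ spectrum A t%:C.
Proof.
move=> bA sA c0 h; apply.
have [||||S [bS SA AS]] := @coercive_inverse (fun x => (- 1)%:C *: A x + t%:C *: x) c.
- by apply: bounded_lin => //; exact: boundedZ bounded_id.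
- by move=> x y; rewrite innerDl innerDr !innerZl !innerZr sA !conjc_real.
- by [].
- by move=> x; rewrite rdotDl !rdotZl rdot_nrm mulN1r addrC.
exists (fun x => (-1)%:C *: S x); split; first exact: boundedZ.
  move=> x; rewrite -linZ; last by case: bS.
  by rewrite rmorphN scaleN1r opprB -[RHS]SA rmorphN scaleN1r addrC.
move=> x; rewrite linZ; last by case: bA.
by rewrite -[RHS]AS rmorphN !scaleN1r scalerN opprK.
Qed.

(** * Polynomials in an operator *)

(** Complex coefficients are needed to split a real polynomial into linear
    factors. *)
Definition cpoly_op (p : {poly R[i]}) A : H -> H :=
  fun x => \sum_(i < size p) p`_i *: iter i A x.

Lemma poly_opE (p : {poly R}) A : poly_op p A = cpoly_op (map_poly (real_complex R) p) A.
Proof.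
apply/funext => x; rewrite /poly_op /cpoly_op size_map_poly.
by apply: eq_bigr => i _; rewrite coef_map.
Qed.

Lemma cpoly_op_widen n (p : {poly R[i]}) A x : (size p <= n)%N ->
  cpoly_op p A x = \sum_(i < n) p`_i *: iter i A x.
Proof.
move=> pn; rewrite /cpoly_op (big_ord_widen n (fun i => p`_i *: iter i A x)) //.
rewrite big_mkcond; apply: eq_bigr => i _; case: ltnP => // h.
by rewrite nth_default // scale0r.
Qed.

Lemma cpoly_opD p q A x : cpoly_op (p + q) A x = cpoly_op p A x + cpoly_op q A x.
Proof.
pose n := maxn (size p) (size q).
rewrite !(@cpoly_op_widen n) ?leq_maxl ?leq_maxr ?size_polyD //.
by rewrite -big_split; apply: eq_bigr => i _; rewrite coefD scalerDl.
Qed.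

Lemma cpoly_opC a A x : cpoly_op a%:P A x = a *: x.
Proof.
by rewrite (@cpoly_op_widen 1) ?size_polyC ?leq_b1 // big_ord1 coefC.
Qed.

Lemma cpoly_opMX p A x : cpoly_op (p * 'X) A x = cpoly_op p A (A x).
Proof.
rewrite (@cpoly_op_widen (size p).+1); last first.
  by rewrite (leq_trans (size_polyMleq _ _)) // size_polyX addn2.
rewrite big_ord_recl coefMX scale0r add0r.
by apply: eq_bigr => i _; rewrite lift0 coefMX iterSr.
Qed.

Lemma cpoly_opZ a p A x : cpoly_op (a *: p) A x = a *: cpoly_op p A x.
Proof.
rewrite (@cpoly_op_widen (size p)) ?size_scale_leq // scaler_sumr.
by apply: eq_bigr => i _; rewrite coefZ scalerA.
Qed.

Lemma cpoly_op_comm p A x : linear A -> cpoly_op p A (A x) = A (cpoly_op p A x).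
Proof.
move=> lA; elim/poly_ind: p x => [|p c IH] x.
  by rewrite -polyC0 !cpoly_opC !scale0r lin0.
by rewrite !cpoly_opD !cpoly_opMX !cpoly_opC (linD lA) (linZ lA) IH.
Qed.

Lemma cpoly_opM p q A x : linear A ->
  cpoly_op (p * q) A x = cpoly_op p A (cpoly_op q A x).
Proof.
move=> lA; elim/poly_ind: p x => [|p c IH] x.
  by rewrite mul0r -polyC0 !cpoly_opC !scale0r.
rewrite mulrDl mulrAC mul_polyC !cpoly_opD !cpoly_opMX cpoly_opZ cpoly_opC IH.
by rewrite cpoly_op_comm.
Qed.

Lemma cpoly_op_XsubC a A x : cpoly_op ('X - a%:P) A x = A x - a *: x.
Proof.
rewrite -[ 'X]mul1r -polyCN cpoly_opD cpoly_opMX -polyC1 !cpoly_opC.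
by rewrite scale1r scaleNr.
Qed.

Lemma bounded_poly_op (p : {poly R}) A : bounded_op A -> bounded_op (poly_op p A).
Proof.
move=> bA; rewrite poly_opE; elim/poly_ind: (map_poly _ p) => [|q c IH].
  have := bounded_zero; congr bounded_op; apply/funext => x.
  by rewrite -polyC0 cpoly_opC scale0r.
have := bounded_lin c bounded_id (bounded_comp IH bA).
congr bounded_op; apply/funext => x.
by rewrite cpoly_opD cpoly_opMX cpoly_opC addrC.
Qed.

Lemma poly_opD (p q : {poly R}) A x : poly_op (p + q) A x = poly_op p A x + poly_op q A x.
Proof. by rewrite !poly_opE rmorphD cpoly_opD. Qed.

Lemma poly_opC (t : R) A x : poly_op t%:P A x = t%:C *: x.
Proof. by rewrite !poly_opE map_polyC cpoly_opC. Qed.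

Lemma poly_opN (p : {poly R}) A x : poly_op (- p) A x = - poly_op p A x.
Proof. by rewrite !poly_opE rmorphN -scaleN1r cpoly_opZ scaleN1r. Qed.

Lemma poly_opM (p q : {poly R}) A x : linear A ->
  poly_op (p * q) A x = poly_op p A (poly_op q A x).
Proof. by move=> lA; rewrite !poly_opE rmorphM cpoly_opM. Qed.

Lemma poly_opX A x : poly_op 'X A x = A x.
Proof. by rewrite poly_opE map_polyX -['X]mul1r cpoly_opMX -polyC1 cpoly_opC scale1r. Qed.

Lemma selfadj_poly_op (p : {poly R}) A : linear A -> selfadj A -> selfadj (poly_op p A).
Proof.
move=> lA sA; elim/poly_ind: p => [|p c IH] x y.
  by rewrite -polyC0 !poly_opC innerZl innerZr conjc_real.
rewrite !poly_opD !poly_opC !poly_opM // !poly_opX innerDl innerDr innerZl innerZr.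
by rewrite conjc_real IH sA !poly_opE cpoly_op_comm.
Qed.

(** * Positivity of polynomials in a self-adjoint operator *)

(** The infimum t of <A x, x> over the unit sphere is an approximate eigenvalue.
    B = A - t is positive, hence |B x|^2 <= D <B x, x> with D a bound for B; if B
    were bounded below by c, then <A x, x> would stay above t + c^2 / D. *)
Lemma selfadj_inf_not_bounded_below A (x0 : H) : bounded_op A -> selfadj A ->
  nrm x0 = 1 ->
  exists t : R, t <= rdot (A x0) x0 /\ ~ bounded_below (fun x => A x - t%:C *: x).
Proof.
move=> bA sA x01; have [lA [C C0 hA]] := (bounded_opP A).1 bA.
pose E := [set rdot (A x) x | x in [set x | nrm x = 1]].
have infE : has_inf E.
  split; first by exists (rdot (A x0) x0), x0.
  exists (- C) => _ [x x1 <-]; have := rdot_norm_le (A x) x.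
  rewrite ler_norml => /andP[h _]; apply: le_trans h.
  by rewrite lerN2 x1 mulr1; have := hA x; rewrite x1 mulr1.
pose t := inf E.
have tE x : nrm x = 1 -> t <= rdot (A x) x.
  by move=> x1; apply: ge_inf; [case: infE | exists x].
exists t; split; first exact: tE.
move=> [c c0 hc]; pose B x := A x - t%:C *: x.
have BE : B = fun x => (- t%:C) *: x + A x.
  by apply/funext => x; rewrite /B -scaleNr addrC.
have bB : bounded_op B by rewrite BE; exact: bounded_lin bounded_id bA.
have sB : selfadj B.
  by rewrite BE => x y; rewrite innerDl innerDr innerZl innerZr sA -rmorphN conjc_real.
have [lB [D' D'0 hB']] := (bounded_opP B).1 bB.
pose D := D' + 1; have D0 : 0 < D by rewrite ltr_wpDl.
have hB x : nrm (B x) <= D * nrm x.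
  by rewrite (le_trans (hB' x)) // ler_wpM2r ?nrm_ge0 // lerDl.
have Brdot x : nrm x = 1 -> rdot (B x) x = rdot (A x) x - t.
  by move=> x1; rewrite /B rdotBl rdotZl rdot_nrm x1 expr1n mulr1.
have Bge0 x : 0 <= rdot (B x) x.
  have [->|/eqP z0] := eqVneq x 0; first by rewrite rdot0r.
  have z1 := nrm_gt0 z0.
  have e : nrm ((nrm x)^-1%:C *: x) = 1.
    by rewrite nrmZR gtr0_norm ?invr_gt0 // mulVf // gt_eqF.
  have := tE _ e; rewrite -subr_ge0 -Brdot // (linZ lB) rdotZl rdotZr.
  by rewrite !pmulr_rge0 ?invr_gt0.
(* positivity of B at x - D^-1 B x *)
have key x : nrm (B x) ^+ 2 <= D * rdot (B x) x.
  have := Bge0 (x + (- D^-1)%:C *: B x).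
  rewrite (linD lB) (linZ lB) rdotDl !rdotDr !rdotZl !rdotZr rdot_nrm.
  rewrite (selfadj_rdot sB (B x) x) rdot_nrm => h.
  have h2 : rdot (B (B x)) (B x) <= D * nrm (B x) ^+ 2.
    by rewrite (le_trans (rdot_le _ _)) // expr2 mulrA ler_wpM2r ?nrm_ge0.
  have h3 : D^-1 ^+ 2 * rdot (B (B x)) (B x) <= D^-1 * nrm (B x) ^+ 2.
    apply: le_trans (ler_wpM2l (sqr_ge0 _) h2) _.
    by rewrite mulrA expr2 -[_ * _ * D]mulrA mulVf ?mulr1 // gt_eqF.
  rewrite -ler_pdivrMl //; move: h h3; rewrite expr2; lra.
have [_ [x x1 <-]] := inf_adherent (divr_gt0 (exprn_gt0 2 c0) D0) infE.
apply/negP; rewrite -leNgt -lerBrDl -/t -Brdot // ler_pdivrMr // mulrC.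
apply: le_trans (key x); rewrite lerXn2r ?nnegrE ?nrm_ge0 ?(ltW c0) //.
by have := hc x; rewrite x1 mulr1.
Qed.

Lemma bounded_below_prod (r : seq R[i]) A : linear A ->
  (forall z : R[i], z \in r -> bounded_below (fun x => A x - z *: x)) ->
  bounded_below (cpoly_op (\prod_(z <- r) ('X - z%:P)) A).
Proof.
move=> lA; elim: r => [|z r IH] h.
  rewrite big_nil; exists 1 => // x.
  by rewrite -polyC1 cpoly_opC scale1r mul1r.
rewrite big_cons; have -> : cpoly_op (('X - z%:P) * \prod_(j <- r) ('X - j%:P)) A =
    (fun x => A x - z *: x) \o cpoly_op (\prod_(j <- r) ('X - j%:P)) A.
  by apply/funext => x; rewrite cpoly_opM // cpoly_op_XsubC.
apply: bounded_below_comp; first by apply: h; rewrite mem_head.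
by apply: IH => w wr; apply: h; rewrite in_cons wr orbT.
Qed.

Lemma selfadj_not_bounded_below_spectrum A (t : R[i]) : selfadj A ->
  ~ bounded_below (fun x => A x - t *: x) ->
  exists2 s : R, t = s%:C & spectrum A s%:C.
Proof.
move=> sA nb; have [t0|/eqP t0] := eqVneq (complex.Im t) 0; last first.
  by case: nb; apply: selfadj_nonreal_bounded_below => //; apply/eqP.
exists (complex.Re t); first by case: t t0 {nb} => a b /= ->.
by apply: spectrum_not_bounded_below; case: t t0 nb => a b /= ->.
Qed.

(** If p(A) - t is not bounded below, then neither is one of the factors A - z of
    its splitting over R[i]; self-adjointness makes z real, and z is a root of
    p - t. When p - t is the zero polynomial there is no factor, and any point of
    the spectrum will do. *)
Lemma spectrum_mapping (p : {poly R}) (t : R) (x0 : H) A : bounded_op A -> selfadj A ->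
  nrm x0 = 1 ->
  ~ bounded_below (fun x => poly_op p A x - t%:C *: x) ->
  exists2 s : R, spectrum A s%:C & p.[s] = t.
Proof.
move=> bA sA x01 nb; have lA : linear A by case: bA.
pose q : {poly R[i]} := map_poly (real_complex R) (p - t%:P).
have qE x : cpoly_op q A x = poly_op p A x - t%:C *: x.
  by rewrite -poly_opE poly_opD poly_opN poly_opC.
have [q0|q0] := eqVneq q 0.
  have [s [_ ns]] := selfadj_inf_not_bounded_below bA sA x01.
  have [s' [<-] ss] := selfadj_not_bounded_below_spectrum sA ns.
  exists s => //; apply/eqP; rewrite -subr_eq0.
  move/eqP: q0; rewrite map_poly_eq0 => /eqP q0.
  by have := congr1 (horner^~ s) q0; rewrite hornerD hornerN hornerC horner0 => ->.
have [r qr] := closed_field_poly_normal q.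
have lc0 : lead_coef q != 0 by rewrite lead_coef_eq0.
have [z zr nz] : exists2 z, z \in r & ~ bounded_below (fun x => A x - z *: x).
  apply: contrapT => nex; apply: nb.
  have [z zr|c c0 h] := @bounded_below_prod r A lA.
    by apply: contrapT => nz; apply: nex; exists z.
  exists (complex.Re `|lead_coef q| * c).
    rewrite mulr_gt0 //; have : 0 < `|lead_coef q| by rewrite normr_gt0.
    by case: `|_| => a b; rewrite ltcE => /andP[].
  move=> x; rewrite -qE; have -> : cpoly_op q A x =
      lead_coef q *: cpoly_op (\prod_(z <- r) ('X - z%:P)) A x.
    by rewrite {1}qr cpoly_opZ.
  rewrite nrmZ -mulrA ler_wpM2l //.
  by case: (lead_coef q) => a b /=; exact: sqrtr_ge0.
have [s zs ss] := selfadj_not_bounded_below_spectrum sA nz.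
exists s => //; apply/eqP; rewrite -subr_eq0.
have : root q z by rewrite qr rootZ // root_prod_XsubC.
rewrite zs /q /root horner_map fmorph_eq0 => /eqP.
by rewrite hornerD hornerN hornerC => ->.
Qed.

(** The bottom of the numerical range of p(A) is a value of p on the spectrum of
    A, by spectral mapping. *)
Lemma poly_op_ge0 (p : {poly R}) A : bounded_op A -> selfadj A ->
  (forall t : R, spectrum A t%:C -> 0 <= p.[t]) ->
  forall x, 0 <= rdot (poly_op p A x) x.
Proof.
move=> bA sA p0 x; have lA : linear A by case: bA.
have bp := bounded_poly_op p bA; have sp := selfadj_poly_op p lA sA.
have [->|/eqP z0] := eqVneq x 0; first by rewrite rdot0r.
have z1 := nrm_gt0 z0.
have e : nrm ((nrm x)^-1%:C *: x) = 1.
  by rewrite nrmZR gtr0_norm ?invr_gt0 // mulVf // gt_eqF.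
have [t [tx nt]] := selfadj_inf_not_bounded_below bp sp e.
have [s ss ps] := spectrum_mapping bA sA e nt.
have := p0 s ss; rewrite ps => /le_trans/(_ tx).
rewrite linZ; last by case: bp.
by rewrite rdotZl rdotZr !pmulr_rge0 ?invr_gt0.
Qed.

(** The quadratic form of e^2 - p(A)^2 is e^2 |x|^2 - |p(A) x|^2, and the polynomial
    e^2 - p^2 is nonnegative on the spectrum. *)
Lemma poly_op_norm_le (p : {poly R}) (e : R) A : bounded_op A -> selfadj A -> 0 <= e ->
  (forall t : R, spectrum A t%:C -> `|p.[t]| <= e) ->
  forall x, nrm (poly_op p A x) <= e * nrm x.
Proof.
move=> bA sA e0 pe x; have lA : linear A by case: bA.
apply: le_of_sqr; first by rewrite mulr_ge0 ?nrm_ge0.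
have := @poly_op_ge0 ((e ^+ 2)%:P - p * p) A bA sA _ x.
rewrite poly_opD poly_opN poly_opC poly_opM // rdotBl rdotZl.
rewrite (selfadj_rdot (selfadj_poly_op p lA sA)) !rdot_nrm subr_ge0 -exprMn; apply.
move=> t /pe h; rewrite hornerD hornerN hornerM hornerC subr_ge0 -expr2.
by rewrite -real_normK ?num_real // lerXn2r.
Qed.

(** * Functional calculus *)

Lemma is_funcalcP A f B : is_funcalc A f B <->
  exists p : nat -> {poly R}, forall e : R, 0 < e -> exists n0, forall n, (n0 <= n)%N ->
    (forall t : R, spectrum A t%:C -> `|(p n).[t] - f t| <= e) /\
    (forall x, nrm (poly_op (p n) A x - B x) <= e * nrm x).
Proof.
split=> -[p].
  move=> [hp hB]; exists p => e e0.
  have [n1 _ h1] := hp e e0; have [n2 _ h2] := hB e e0.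
  exists (maxn n1 n2) => n; rewrite geq_max => /andP[/h1 hn1 /h2 hn2].
  by split=> // x; have := hn2 x; rewrite !nrmE -rmorphM lecR.
move=> h; exists p; split=> e /h[n0 hn0]; exists n0 => // n /hn0[] //.
by move=> _ hn x; rewrite !nrmE -rmorphM lecR.
Qed.

(** The norm bound poly_op_norm_le makes p n (A) a Cauchy sequence for the operator
    norm. *)
Lemma funcalc_exists A f (p : nat -> {poly R}) : bounded_op A -> selfadj A ->
  poly_approx p f [set t | spectrum A t%:C] ->
  exists B, bounded_op B /\ is_funcalc A f B.
Proof.
move=> bA sA hp.
have pc (e : R) : 0 < e -> exists n0, forall m n, (n0 <= m)%N -> (n0 <= n)%N ->
    forall x, nrm (poly_op (p m) A x - poly_op (p n) A x) <= e * nrm x.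
  move=> e0; have [n0 h] := hp _ (divr_gt0 e0 (ltr0n R 2)).
  exists n0 => m n hm hn x; rewrite -poly_opN -poly_opD.
  apply: poly_op_norm_le => //; first exact: ltW.
  move=> t ht; rewrite hornerD hornerN.
  have := h m hm t ht; have := h n hn t ht; rewrite [`|(p n).[t] - _|]distrC.
  have := ler_distD (f t) (p m).[t] (p n).[t]; lra.
have /choice[B hB] x : exists l, converges (fun n => poly_op (p n) A x) l.
  apply: (@complete_seq (fun n => poly_op (p n) A x)) => e e0.
  have x1 : 0 < nrm x + 1 by rewrite ltr_wpDl ?nrm_ge0.
  have [n0 h] := pc _ (divr_gt0 e0 x1); exists n0 => m n hm hn.
  apply: le_trans (h m n hm hn x) _.
  by rewrite mulrAC ler_pdivrMr // ler_pM2l // lerDl.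
have BA (e : R) : 0 < e -> exists n0, forall n, (n0 <= n)%N ->
    forall x, nrm (poly_op (p n) A x - B x) <= e * nrm x.
  move=> e0; have [n0 h] := pc e e0; exists n0 => n hn x.
  by rewrite nrmBC; apply: (@nrm_lim_le _ _ _ _ n0 (hB x)) => m hm; exact: h.
have bB : bounded_op B.
  apply/bounded_opP; split.
    move=> a u v; apply/subr0_eq/nrm_eq0/eqP; rewrite eq_le nrm_ge0 andbT.
    apply: (@eps_le0 _ _ (nrm (a *: u + v) + complex.Re `|a| * nrm u + nrm v)) => e e0 _.
    have [n0 h] := BA e e0; have hn := h n0 (leqnn _).
    have [lp _] := bounded_poly_op (p n0) bA; set P := poly_op (p n0) A in lp hn.
    have -> : B (a *: u + v) - (a *: B u + B v) =
        (B (a *: u + v) - P (a *: u + v)) + (a *: (P u - B u) + (P v - B v)).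
      have -> : P (a *: u + v) = a *: P u + P v := lp a u v.
      rewrite scalerBr; move: (a *: P u) (P v) (a *: B u) (B v) (B _) => q q' y y' w.
      by rewrite (addrACA q) (addrA (w - _)) subrK opprD.
    rewrite (le_trans (nrmD _ _)) // !mulrDr -addrA lerD //.
      by rewrite nrmBC.
    rewrite (le_trans (nrmD _ _)) // lerD // nrmZ mulrCA ler_wpM2l //.
    by case: (a) => a1 a2 /=; exact: sqrtr_ge0.
  have [n0 h] := BA 1 ltr01; have hn := h n0 (leqnn _).
  have [_ [C C0 hC]] := (bounded_opP _).1 (bounded_poly_op (p n0) bA).
  exists (1 + C); first by rewrite addr_ge0.
  move=> x; rewrite -[B x](subrK (poly_op (p n0) A x)) (le_trans (nrmD _ _)) //.
  by rewrite mulrDl lerD // nrmBC.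
exists B; split=> //; apply/is_funcalcP; exists p => e e0.
have [n1 h1] := hp e e0; have [n2 h2] := BA e e0.
exists (maxn n1 n2) => n; rewrite geq_max => /andP[/h1 hn1 /h2 hn2].
by split.
Qed.

Lemma funcalcP A f : (exists B, bounded_op B /\ is_funcalc A f B) ->
  bounded_op (funcalc A f) /\ is_funcalc A f (funcalc A f).
Proof. by move=> [B hB]; rewrite /funcalc; case: xgetP => [_ ->|/(_ B)]. Qed.

Lemma funcalc_uniq A f B B' : bounded_op A -> selfadj A ->
  is_funcalc A f B -> is_funcalc A f B' -> B = B'.
Proof.
move=> bA sA /is_funcalcP[p hp] /is_funcalcP[p' hp']; apply/funext => x.
apply/subr0_eq/nrm_eq0/eqP; rewrite eq_le nrm_ge0 andbT.
apply: (@eps_le0 _ _ (4 * nrm x)) => e e0 _.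
have [n hn] := hp e e0; have [n' hn'] := hp' e e0.
have {hn}[h1 h2] := hn n (leqnn _); have {hn'}[h1' h2'] := hn' n' (leqnn _).
have h3 : nrm (poly_op (p n) A x - poly_op (p' n') A x) <= 2 * e * nrm x.
  rewrite -poly_opN -poly_opD.
  apply: poly_op_norm_le => //; first by rewrite mulr_ge0 // ltW.
  move=> t ht; rewrite hornerD hornerN.
  have := h1 t ht; have := h1' t ht; rewrite [`|(p' n').[t] - _|]distrC.
  have := ler_distD (f t) (p n).[t] (p' n').[t]; lra.
have := nrmB_trans (poly_op (p n) A x) (B x) (B' x).
have := nrmB_trans (poly_op (p' n') A x) (poly_op (p n) A x) (B' x).
have := h2 x; have := h2' x; rewrite (nrmBC _ (B x)); lra.
Qed.

Lemma funcalc_selfadj A f B : bounded_op A -> selfadj A -> linear B ->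
  is_funcalc A f B -> selfadj B.
Proof.
move=> bA sA lB /is_funcalcP[p hp].
have key x y : rdot (B x) y = rdot x (B y).
  apply/eqP; rewrite -subr_eq0 -normr_le0.
  apply: (@eps_le0 _ _ (2 * (nrm x * nrm y))) => e e0 _.
  have [n hn] := hp e e0; have {hn}[_ h] := hn n (leqnn _).
  have [lA _] := bA.
  have sP := selfadj_rdot (selfadj_poly_op (p n) lA sA) x y.
  have -> : rdot (B x) y - rdot x (B y) = rdot x (poly_op (p n) A y - B y) -
      rdot (poly_op (p n) A x - B x) y by rewrite rdotBl rdotBr sP; ring.
  rewrite (le_trans (ler_normB _ _)) // mulrA mulr_natr mulrnAl mulr2n lerD //.
    rewrite (le_trans (rdot_norm_le _ _)) // mulrCA ler_wpM2l ?nrm_ge0 //.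
  by rewrite (le_trans (rdot_norm_le _ _)) // mulrA ler_wpM2r ?nrm_ge0.
by move=> x y; rewrite innerE innerE !key (linZ lB).
Qed.

(** Monotonicity of the functional calculus against polynomial lower bounds; it
    gives both the positivity of |T| and McCarthy's inequality. *)
Lemma funcalc_ge_poly A f B (q : {poly R}) : bounded_op A -> selfadj A ->
  is_funcalc A f B -> (forall t : R, spectrum A t%:C -> q.[t] <= f t) ->
  forall x, rdot (poly_op q A x) x <= rdot (B x) x.
Proof.
move=> bA sA /is_funcalcP[p hp] qf x; rewrite -subr_le0.
apply: (@eps_le0 _ _ (2 * nrm x ^+ 2)) => e e0 _.
have [n hn] := hp e e0; have {hn}[h1 h2] := hn n (leqnn _).
have := @poly_op_ge0 (p n + e%:P - q) A bA sA _ x.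
rewrite !poly_opD poly_opN poly_opC rdotBl rdotDl rdotZl rdot_nrm => h3.
have h4 : 0 <= rdot (poly_op (p n) A x) x + e * nrm x ^+ 2 - rdot (poly_op q A x) x.
  apply: h3 => t ht; rewrite !hornerD hornerN hornerC.
  have := h1 t ht; rewrite ler_norml => /andP[h _]; have := qf t ht; lra.
have h5 : rdot (poly_op (p n) A x - B x) x <= e * nrm x ^+ 2.
  by rewrite (le_trans (rdot_le _ _)) // expr2 mulrA ler_wpM2r ?nrm_ge0.
move: h5; rewrite rdotBl; lra.
Qed.

(** A square root of the identity function on the spectrum gives an operator B
    with B^2 = A; only the resulting identity of quadratic forms is recorded. The
    bound F controls the squares of the approximating polynomials. *)
Lemma funcalc_sqr A f B (F : R) : bounded_op A -> selfadj A ->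
  is_funcalc A f B -> (forall t : R, spectrum A t%:C -> f t ^+ 2 = t /\ `|f t| <= F) ->
  forall x, nrm (B x) ^+ 2 = rdot (A x) x.
Proof.
move=> bA sA /is_funcalcP[p hp] hf x; apply/eqP; rewrite -subr_eq0 -normr_le0.
have lA : linear A by case: bA.
pose K := (2 * `|F| + 1) * nrm x ^+ 2 + nrm x * (2 * nrm (B x) + nrm x).
apply: (@eps_le0 _ _ K) => e e0 e1.
have [n hn] := hp e e0; have {hn}[h1 h2] := hn n (leqnn _).
pose P := poly_op (p n) A.
have sP := selfadj_rdot (selfadj_poly_op (p n) lA sA).
have h3 : nrm (P (P x) - A x) <= e * (2 * `|F| + 1) * nrm x.
  rewrite /P -poly_opM // -(poly_opX A x) -poly_opN -poly_opD.
  apply: poly_op_norm_le => //; first by rewrite mulr_ge0 ?addr_ge0 ?mulr_ge0 ?(ltW e0).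
  move=> t ht; rewrite hornerD hornerN hornerM hornerX.
  have [ft fF] := hf t ht; have := h1 t ht; set u := (p n).[t] - f t => hu.
  have -> : (p n).[t] * (p n).[t] - t = u * (2 * f t + u) by rewrite -[X in _ - X = _]ft /u; ring.
  rewrite normrM ler_pM // (le_trans (ler_normD _ _)) // lerD //.
    by rewrite normrM ger0_norm // ler_pM2l // (le_trans fF) // ler_norm.
  exact: le_trans hu e1.
have h4 : `|nrm (P x) ^+ 2 - rdot (A x) x| <= e * ((2 * `|F| + 1) * nrm x ^+ 2).
  rewrite -rdot_nrm {2}/P -sP -rdotBl (le_trans (rdot_norm_le _ _)) //.
  by rewrite expr2 !mulrA ler_wpM2r ?nrm_ge0 // -mulrA.
have h5 : `|nrm (P x) - nrm (B x)| <= e * nrm x.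
  have := h2 x; have := nrmB_trans 0 (P x) (B x).
  have a1 : nrm (P x) <= nrm (P x - B x) + nrm (B x) by rewrite -{1}[P x](subrK (B x)) nrmD.
  have a2 : nrm (B x) <= nrm (P x - B x) + nrm (P x).
    by rewrite nrmBC -{1}[B x](subrK (P x)) nrmD.
  by rewrite ler_norml -/P => _ h; apply/andP; split; lra.
have h6 : `|nrm (B x) ^+ 2 - nrm (P x) ^+ 2| <= e * (nrm x * (2 * nrm (B x) + nrm x)).
  rewrite subr_sqr normrM distrC mulrA ler_pM // ger0_norm ?addr_ge0 ?nrm_ge0 //.
  move: h5; rewrite ler_norml => /andP[_ h5].
  have : e * nrm x <= nrm x by rewrite ler_piMl ?nrm_ge0.
  lra.
have := ler_distD (nrm (P x) ^+ 2) (nrm (B x) ^+ 2) (rdot (A x) x).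
by rewrite /K mulrDr; lra.
Qed.

Lemma selfadj_spectrum_le A (l u : R) : bounded_op A -> selfadj A ->
  (forall x, l * nrm x ^+ 2 <= rdot (A x) x <= u * nrm x ^+ 2) ->
  forall t : R, spectrum A t%:C -> l <= t <= u.
Proof.
move=> bA sA h t ht; apply/andP; split; rewrite leNgt; apply/negP => lt.
  apply: (selfadj_lt_not_spectrum (c := l - t) bA sA _ _ ht).
    by rewrite subr_gt0; exact: lt.
  by move=> x; have /andP[h1 _] := h x; rewrite mulrBl lerD2r.
apply: (selfadj_gt_not_spectrum (c := t - u) bA sA _ _ ht).
  by rewrite subr_gt0; exact: lt.
by move=> x; have /andP[_ h1] := h x; rewrite mulrBl lerD2l lerN2.
Qed.

(** * Absolute values and powers *)

Lemma abs_opP T : bounded_op T ->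
  [/\ bounded_op (abs_op T), selfadj (abs_op T),
      forall x, 0 <= rdot (abs_op T x) x &
      forall x, nrm (abs_op T x) = nrm (T x)].
Proof.
move=> bT; have adT := adjointP bT; pose A := adjoint T \o T.
have bA : bounded_op A by apply: bounded_comp => //; exact: bounded_adjoint.
have sA : selfadj A := adjoint_pair_comp (adjoint_pairC adT) adT.
have [lT [C C0 hT]] := (bounded_opP T).1 bT.
have rA x : rdot (A x) x = nrm (T x) ^+ 2.
  by rewrite /A /= (adjoint_pair_rdot (adjoint_pairC adT)) rdot_nrm.
pose L := C ^+ 2 + 1; have L0 : 0 < L by rewrite ltr_wpDl ?sqr_ge0.
have sp t : spectrum A t%:C -> 0 <= t <= L.
  apply: selfadj_spectrum_le => // x; rewrite rA mul0r sqr_ge0 /=.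
  apply: (@le_trans _ _ (C ^+ 2 * nrm x ^+ 2)).
    by rewrite -exprMn lerXn2r ?nnegrE ?mulr_ge0 ?nrm_ge0.
  by rewrite ler_wpM2r ?sqr_ge0 // lerDl.
have [p hp] := sqrt_approx L0.
have ex : exists B, bounded_op B /\ is_funcalc A (fun t => t `^ (1 / 2)) B.
  apply: (funcalc_exists (p := p)) => // e /hp[n0 h].
  by exists n0 => n hn t /sp; exact: h.
have [bB fB] := funcalcP ex; have lB : linear (abs_op T) by case: bB.
split; [exact: bB|exact: funcalc_selfadj fB| | ].
  move=> x; have := funcalc_ge_poly bA sA fB (q := 0) _ x.
  rewrite -polyC0 poly_opC scale0r rdot0l; apply => t _.
  by rewrite hornerC powR_ge0.
move=> x; have := @funcalc_sqr A _ _ (Num.sqrt L) bA sA fB _ x.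
rewrite rA => h; apply/eqP; rewrite -(eqrXn2 (n := 2)) ?nrm_ge0 //; apply/eqP/h.
move=> t /sp /andP[t0 tL]; rewrite div1r powR12_sqrt // sqr_sqrtr //.
by split=> //; rewrite ger0_norm ?sqrtr_ge0 // ler_wsqrtr.
Qed.

(** McCarthy's inequality <A^2 x, x>^r <= <A^(2r) x, x>. With a = <A^2 x, x>, the
    tangent at a of u |-> u^r evaluated at u = t^2 is a polynomial in t below
    t^(2r), whose value at A has quadratic form exactly a^r at the unit vector x. *)
Lemma rpow_op_mccarthy A (r : R) : bounded_op A -> selfadj A ->
  (forall x, 0 <= rdot (A x) x) -> 1 <= r ->
  [/\ bounded_op (rpow_op A (2 * r)), selfadj (rpow_op A (2 * r)) &
    forall x, nrm x = 1 -> (nrm (A x) ^+ 2) `^ r <= rdot (rpow_op A (2 * r) x) x].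
Proof.
move=> bA sA A0 r1; have [lA [C C0 hA]] := (bounded_opP A).1 bA.
pose L := C + 1; have L0 : 0 < L by rewrite ltr_wpDl.
have sp t : spectrum A t%:C -> 0 <= t <= L.
  apply: selfadj_spectrum_le => // x; rewrite mul0r A0 /=.
  rewrite (le_trans (rdot_le _ _)) // expr2 mulrA ler_wpM2r ?nrm_ge0 //.
  by rewrite (le_trans (hA x)) // ler_wpM2r ?nrm_ge0 // lerDl.
have r2 : 1 <= 2 * r by lra.
have [p hp] := powR_approx L0 r2.
have ex : exists B, bounded_op B /\ is_funcalc A (fun t => t `^ (2 * r)) B.
  apply: (funcalc_exists (p := p)) => // e /hp[n0 h].
  by exists n0 => n hn t /sp; exact: h.
have [bB fB] := funcalcP ex; have lB : linear (rpow_op A (2 * r)) by case: bB.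
split; [exact: bB|exact: funcalc_selfadj fB| ].
move=> x x1; set a := nrm (A x) ^+ 2.
have a0 : 0 <= a by exact: sqr_ge0.
(* the tangent of u |-> u^r at a, at u = 'X^2 *)
pose q : {poly R} := (a `^ r)%:P + (r * a `^ (r - 1))%:P * ('X * 'X - a%:P).
have := funcalc_ge_poly bA sA fB (q := q) _ x.
rewrite /q poly_opD poly_opM // poly_opD poly_opN poly_opM // !poly_opX !poly_opC.
rewrite rdotDl !rdotZl rdotBl rdotZl rdot_nrm x1 expr1n !mulr1.
rewrite selfadj_rdot // rdot_nrm -/a subrr mulr0 addr0; apply.
move=> t /sp /andP[t0 _].
rewrite hornerD hornerM hornerD hornerN hornerM !hornerX !hornerC.
have -> : t `^ (2 * r) = (t * t) `^ r.
  by rewrite powRrM -expr2 -powR_mulrn.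
by apply: powR_tangent => //; rewrite mulr_ge0.
Qed.

Lemma proj_spectrum (P : H -> H) (a : R[i]) : bounded_op P -> P \o P = P ->
  spectrum P a -> a = 0 \/ a = 1.
Proof.
move=> bP PP; apply: contraPP => /not_orP[/eqP a0 /eqP a1]; apply.
have PPx x : P (P x) = P x by have := congr1 (@^~ x) PP.
have lP : linear P by case: bP.
have a1' : 1 - a != 0 by rewrite subr_eq0 eq_sym.
(* on the range of P the resolvent is (1 - a)^-1, on its kernel it is - a^-1 *)
pose b := a^-1 + (1 - a)^-1.
have e1 : b * (1 - a) - a^-1 = 0 by rewrite /b; field; rewrite a0.
have e2 : - (- a^-1 * a) = 1 by rewrite mulNr opprK mulVf.
have PaP x : P x - a *: P x = (1 - a) *: P x by rewrite scalerBl scale1r.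
exists (fun x => b *: P x + (- a^-1) *: x); split.
- by apply: bounded_lin => //; exact: boundedZ bounded_id.
- move=> x; rewrite (linB lP) (linZ lP) PPx PaP scalerA scalerBr addrA -scalerDl.
  by rewrite e1 scale0r add0r scalerA -scaleNr e2 scale1r.
- move=> x; rewrite (linD lP) !(linZ lP) PPx scalerDr opprD !scalerA addrACA.
  have e3 : b - a * b = a^-1 by apply: subr0_eq; rewrite -e1; ring.
  have e4 : a * - a^-1 = -1 by rewrite mulrN mulfV.
  by rewrite -scalerBl e3 e4 scaleN1r opprK addrA -scalerDl subrr scale0r add0r.
Qed.

(** On the spectrum of a projection, contained in {0, 1}, t^r is the identity. *)
Lemma rpow_op_proj P (r : R) : bounded_op P -> selfadj P -> P \o P = P -> 1 <= r ->
  rpow_op P r = P.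
Proof.
move=> bP sP PP r1; have r0 : r != 0 by rewrite gt_eqF // (lt_le_trans ltr01).
have fP : is_funcalc P (fun t => t `^ r) P.
  apply/is_funcalcP; exists (fun=> 'X) => e e0; exists 0%N => n _; split.
    move=> t /(proj_spectrum bP PP)[]/complexI ->.
      by rewrite hornerX powR0 // subrr normr0 ltW.
    by rewrite hornerX powR1 subrr normr0 ltW.
  by move=> x; rewrite poly_opX subrr nrm0 mulr_ge0 ?nrm_ge0 // ltW.
have [_ fP'] := funcalcP (ex_intro _ P (conj bP fP)).
exact: (funcalc_uniq bP sP fP' fP).
Qed.

(** * Berezin numbers *)

(** As P = T T^dagger fixes the range of T, <T x, x> = <T x, P x>, so that
    |<T x, x>| <= |T x| |P x|. Raising to the power r and using
    2 a^r b^r <= a^(2r) + b^(2r), the term in |T x| = | |T| x | is bounded by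
    McCarthy's inequality; for the other, |P x| <= 1 gives
    |P x|^(2r) <= |P x|^2 = <P x, x> = <P^r x, x>. *)
Lemma pow_inner_le T (r : R) : bounded_op T -> closed (range T) -> 1 <= r ->
  let A := rpow_op (abs_op T) (2 * r) in
  let P := rpow_op (T \o mp_inverse T) r in
  [/\ bounded_op A, selfadj A, bounded_op P, selfadj P &
    forall x, nrm x = 1 ->
      2 * (complex.Re `|'[T x, x]|) `^ r <= rdot (A x) x + rdot (P x) x].
Proof.
move=> bT cT r1; have r0 : 0 < r by rewrite (lt_le_trans ltr01).
have [bB sB B0 hB] := abs_opP bT.
have [bA sA hA] := rpow_op_mccarthy bB sB B0 r1.
have [bS TST sP] := mp_inverseP bT cT; set P := T \o mp_inverse T in sP *.
have bP : bounded_op P by exact: bounded_comp.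
have PP : P \o P = P.
  by apply/funext => z; rewrite /P /=; have := congr1 (@^~ (mp_inverse T z)) TST.
have PT x : P (T x) = T x by have := congr1 (@^~ x) TST.
rewrite /= (@rpow_op_proj P) //; split=> // x x1; have h1 := hA x x1.
have Px : rdot (P x) x = nrm (P x) ^+ 2.
  have PPx : P (P x) = P x := congr1 (@^~ x) PP.
  by rewrite -rdot_nrm -(selfadj_rdot sP) PPx.
have Px1 : nrm (P x) <= 1.
  have := rdot_le (P x) x; rewrite Px x1 mulr1 expr2.
  have := nrm_ge0 (P x); rewrite le_eqVlt => /predU1P[<-//|p0].
  by rewrite -[leRHS]mulr1 ler_pM2l.
have h2 : complex.Re `|'[T x, x]| <= nrm (T x) * nrm (P x).
  by rewrite -PT sP PT inner_norm_le.
rewrite hB in h1; rewrite Px.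
set a := nrm (T x) in h1 h2 *; set b := nrm (P x) in Px1 h2 *.
have a0 : 0 <= a by exact: nrm_ge0. have b0 : 0 <= b by exact: nrm_ge0.
have c0 : 0 <= complex.Re `|'[T x, x]|.
  by case: '[T x, x] => u v; rewrite normc_def /= sqrtr_ge0.
have h3 : (complex.Re `|'[T x, x]|) `^ r <= a `^ r * b `^ r.
  rewrite -powRM // ge0_ler_powR ?nnegrE ?(ltW r0) ?mulr_ge0 //.
have h4 : (b `^ r) ^+ 2 <= b ^+ 2.
  rewrite lerXn2r ?nnegrE ?powR_ge0 //.
  have [->|bn0] := eqVneq b 0; first by rewrite powR0 // gt_eqF.
  by apply: ge1r_powR => //; rewrite lt_neqAle eq_sym bn0 b0.
have h5 : (a ^+ 2) `^ r = (a `^ r) ^+ 2 by rewrite expr2 powRM // -expr2.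
have := sqr_ge0 (a `^ r - b `^ r); rewrite sqrrB => h6.
move: h1; rewrite h5 => h1; apply: (@le_trans _ _ (2 * (a `^ r * b `^ r))).
  by rewrite ler_pM2l.
lra.
Qed.

Definition has_kernel (z : X) := @repr_kernel R X H z != 0.

Lemma nrm_normalized_kernel (z : X) : has_kernel z ->
  nrm (normalized_kernel z : H) = 1.
Proof.
move=> /eqP z0; have := nrm_gt0 z0; rewrite /normalized_kernel nrmE.
set c := nrm _ => c0; have -> : (c%:C)^-1 = (c^-1)%:C by rewrite fmorphV.
by rewrite nrmZR gtr0_norm ?invr_gt0 // mulVf // gt_eqF.
Qed.

(** Boundedness of T is what makes the supremum defining ber a genuine upper
    bound. *)
Lemma inner_le_ber T (z : X) : bounded_op T -> has_kernel z ->
  complex.Re `|'[T (normalized_kernel z), normalized_kernel z]| <= ber T.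
Proof.
move=> /bounded_opP[_ [C C0 hC]] hz; apply: sup_upper_bound; last by exists z.
split; first by eexists; exists z => //; exact: hz.
exists C => _ [w hw <-]; have w1 := nrm_normalized_kernel hw.
by rewrite (le_trans (inner_norm_le _ _)) // w1 mulr1 (le_trans (hC _)) // w1 mulr1.
Qed.

End Hilbert.

Theorem theorem3p13 (R : realType) (X : Type) (X_nonempty : inhabited X)
    (H : rkhs R X) (M N : H -> H)
    (M_bounded : bounded_op M) (N_bounded : bounded_op N)
    (M_closed_range : closed (range M)) (N_closed_range : closed (range N))
    (r : R) (r_ge1 : 1 <= r) :
  ber (M + N) `^ r <=
    2 `^ (r - 1) / Num.sqrt 2 *
    ber (rpow_op (abs_op M) (2 * r) + rpow_op (abs_op N) (2 * r)
         + 'i%C *: (rpow_op (M \o mp_inverse M) r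
                    + rpow_op (N \o mp_inverse N) r)).
Proof.
have r0 : 0 < r by rewrite (lt_le_trans ltr01).
have [bA1 sA1 bP1 sP1 h1] := pow_inner_le M_bounded M_closed_range r_ge1.
have [bA2 sA2 bP2 sP2 h2] := pow_inner_le N_bounded N_closed_range r_ge1.
set A1 := rpow_op (abs_op M) _ in bA1 sA1 h1 *.
set A2 := rpow_op (abs_op N) _ in bA2 sA2 h2 *.
set P1 := rpow_op (M \o _) _ in bP1 sP1 h1 *.
set P2 := rpow_op (N \o _) _ in bP2 sP2 h2 *.
set Q := A1 + A2 + 'i%C *: (P1 + P2).
have bQ : bounded_op Q.
  exact: boundedD (boundedD bA1 bA2) (boundedZ _ (boundedD bP1 bP2)).
pose K : R := 2 `^ (r - 1) / Num.sqrt 2.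
have K0 : 0 <= K by rewrite divr_ge0 ?powR_ge0 ?sqrtr_ge0.
rewrite -/K.
have s20 : 0 < Num.sqrt (2 : R) by rewrite sqrtr_gt0.
have re_ge0 (c : R[i]) : 0 <= complex.Re `|c|.
  by case: c => u v; rewrite normc_def /= sqrtr_ge0.
have main z : has_kernel (H := H) z ->
    complex.Re `|inner H ((M + N) (normalized_kernel z)) (normalized_kernel z)| `^ r
    <= K * ber Q.
  move=> hz; set k : H := normalized_kernel z.
  have k1 : nrm k = 1 by exact: nrm_normalized_kernel.
  apply: (@le_trans _ _ (K * complex.Re `|inner H (Q k) k|)); last first.
    by rewrite ler_wpM2l // inner_le_ber.
  have := h1 k k1; have := h2 k k1.
  set a := complex.Re `|inner H (M k) k|; set b := complex.Re `|inner H (N k) k|.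
  move=> hb ha; apply: (@le_trans _ _ ((a + b) `^ r)).
    rewrite ge0_ler_powR ?nnegrE ?addr_ge0 ?(ltW r0) ?re_ge0 //.
    rewrite /a /b -(@lecR R) rmorphD /=.
    have reE (c : R[i]) : (complex.Re `|c|)%:C = `|c| by rewrite RRe_real // normr_real.
    by rewrite !reE innerDl ler_normD.
  apply: le_trans (powR_addr_le _ _ r_ge1) _; rewrite ?re_ge0 //.
  rewrite /K -!mulrA ler_wpM2l ?powR_ge0 // mulrC ler_pdivlMr //.
  have -> : inner H (Q k) k = (rdot (A1 k) k + rdot (A2 k) k) +i*
      (rdot (P1 k) k + rdot (P2 k) k).
    have -> : Q k = A1 k + A2 k + 'i%C *: (P1 k + P2 k) by [].
    rewrite !innerDl innerZl !innerDl (selfadj_inner _ sA1) (selfadj_inner _ sA2).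
    rewrite (selfadj_inner _ sP1) (selfadj_inner _ sP2).
    by rewrite -!rmorphD [RHS]complexE.
  rewrite normc_def /=.
  by apply: addr_le_modulus => //; exact: powR_ge0.
(* if every kernel vanishes, both Berezin numbers are 0 *)
have [[z hz]|nz] := pselect (exists z, has_kernel (H := H) z); last first.
  have E0 T : ber (H := H) T = 0.
    rewrite /ber (_ : [set x | _] = set0) ?image_set0 ?sup0 //.
    by apply/seteqP; split=> // z hz; apply: nz; exists z.
  by rewrite !E0 powR0 ?mulr0 // gt_eqF.
have B0 : 0 <= K * ber Q by rewrite (le_trans _ (main z hz)) // powR_ge0.
have -> : K * ber Q = ((K * ber Q) `^ r^-1) `^ r.
  by rewrite -powRrM mulVf ?gt_eqF // powRr1.
rewrite ge0_ler_powR ?nnegrE ?(ltW r0) ?powR_ge0 //.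
  apply: le_trans (inner_le_ber _ hz); first exact: re_ge0.
  exact: boundedD.
apply: ge_sup; first by eexists; exists z => //; exact: hz.
move=> _ [w hw <-]; rewrite -[leLHS]powRr1 ?re_ge0 // -[X in _ `^ X <= _](mulfV (lt0r_neq0 r0)).
rewrite powRrM ge0_ler_powR ?nnegrE ?powR_ge0 ?invr_ge0 ?(ltW r0) //.
exact: main.
Qed.
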